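(* Let $n\ge2$, $m\in\mathbb{Z}$. For $J\in\mathcal{C}(L_m)$ let $v_J\in\mathcal{F}$ be the vector $v_J=\widehat{E}_{p_1,q_1}\cdots\widehat{E}_{p_\ell,q_\ell}\,\epsilon_{\mathrm{roof}(J)}$, where $\mathrm{up}^i(J)=\mathrm{up}^{i-1}(J)\setminus p_i\cup q_i$ for $i=1,\dots,\ell$ and $\mathrm{roof}(J)=\mathrm{up}^\ell(J)$, and write $$v_J=\sum_{K}a_K^J\,\epsilon_K,\qquad a_K^J\in\mathbb{C}.$$ (i) $a_K^J\ne0$ only if $K\le J$ in lexicographic order. (ii) $a_J^J\neq0$ for every $J\in\mathcal{C}(L_m)$, given explicitly as follows. If $J$ is $n$-stable, then $a_J^J=1$. If $J$ is $n$-bounded but not $n$-stable, with $p_i,q_i$ defined by $\mathrm{up}^i(J)=\mathrm{up}^{i-1}(J)\setminus p_i\cup q_i$ for $i=1,\dots,\ell$, where $\mathrm{roof}(J)=\mathrm{up}^\ell(J)$, let $t$ be maximal such that $p_1\equiv\cdots\equiv p_t \bmod n$, define $\mu_d:=\#\{\,i\le t\mid q_i-p_i=d\,\}$, and let $\widetilde{J}:=\mathrm{up}^t(J)$. Then $$a_J^J=\pm\Big(\prod_{d\ge1}\mu_d!\Big)\,a_{\widetilde{J}}^{\widetilde{J}}.$$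
   Context: Fix an integer $n\ge 2$. **Sets.** $\mathcal{T}$ is the collection of all $J\subset\mathbb{Z}$ such that $J\setminus\mathbb{Z}_{\le0}$ and $\mathbb{Z}_{\le0}\setminus J$ are both finite. Write $J=\{\cdots<j_{-2}<j_{-1}<j_0\}$. The order of $J$ is $\mathrm{ord}(J)=|J\setminus\mathbb{Z}_{\le0}|-|\mathbb{Z}_{\le0}\setminus J|$. $J$ is $n$-bounded if $j_i-j_{i-1}\le n$ for all $i$; $J$ is $n$-stable if $j-n\in J$ for all $j\in J$. For $m\in\mathbb{Z}$ let $L_m=\mathbb{Z}_{\le m}$ and $\mathcal{C}(L_m)=\{J\in\mathcal{T}\mid \mathrm{ord}(J)=m,\ J\text{ is }n\text{-bounded}\}$. Notation: $J\setminus p\cup q:=(J\setminus\{p\})\cup\{q\}$. **Lexicographic order.** For $K=\{\cdots<k_{-1}<k_0\}$ and $J=\{\cdots<j_{-1}<j_0\}$ in $\mathcal{T}$: $K<J$ lexicographically iff there is $N$ with $k_N<j_N$ and $k_i=j_i$ for all $i<N$; $K\le J$ means $K<J$ or $K=J$. **Roof.** If $J$ is $n$-bounded but not $n$-stable, define $\mathrm{up}(J)=J\setminus p\cup q$, where $p=\max\{p'\mid p'\in J,\ p'-n\notin J\}$ and $q=\min\{q'>p\mid q'\notin J,\ q'-n\in J,\ q'\not\equiv p\bmod n\}$. Iterating $\mathrm{up}$ on $J\in\mathcal{C}(L_m)$ one stays in $\mathcal{C}(L_m)$ and reaches after finitely many steps an $n$-stable set, $\mathrm{roof}(J):=\mathrm{up}^\ell(J)$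 (with $\ell=0$, so $v_J=\epsilon_J$, if $J$ is already $n$-stable). **Fock space.** $\mathcal{F}$ is the $\mathbb{C}$-vector space with basis $\{\epsilon_J\mid J\in\mathcal{T}\}$, where $\epsilon_J$ stands for the semi-infinite wedge $\cdots\wedge\epsilon_{j_{-2}}\wedge\epsilon_{j_{-1}}\wedge\epsilon_{j_0}$. For $i<j$ in $\mathbb{Z}$, the operator $E'_{ij}$ on $\mathcal{F}$ is given by $E'_{ij}(\epsilon_J)=(-1)^{|J\cap[i,j]|-1}\epsilon_{J\setminus j\cup i}$ if $j\in J$, $i\notin J$, and $E'_{ij}(\epsilon_J)=0$ otherwise. For $p<q$ put $\widehat{E}_{pq}=\sum_{k\in\mathbb{Z}}E'_{p+nk,\,q+nk}$, a well-defined operator on $\mathcal{F}$. *)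

(* Defs.v *)
From HB Require Import structures.
From mathcomp Require Import all_boot all_order all_algebra.
From mathcomp Require Import finmap boolp classical_sets functions cardinality fsbigop reals.
From mathcomp Require Import complex.
From mathcomp Require Import freeg.
From mathcomp Require Import zify.

Set Implicit Arguments.
Unset Strict Implicit.
Unset Printing Implicit Defensive.

Import Order.TTheory GRing.Theory Num.Theory.

Local Open Scope classical_set_scope.
Local Open Scope ring_scope.

(* Junk value 0 when the extremum does not exist. *)
Definition maxz (A : set int) : int :=
  xget 0 [set x | A x /\ forall y, A y -> y <= x].
Definition minz (A : set int) : int :=
  xget 0 [set x | A x /\ forall y, A y -> x <= y].

Definition Zle (m : int) : set int := [set x | x <= m].

Definition cardz (A : set int) : nat := size (fset_set A).

Definition in_TT (J : set int) : Prop :=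
  finite_set (J `\` Zle 0) /\ finite_set (Zle 0 `\` J).

Record TT : Type := MkTT { carrier :> set int; _ : `[< in_TT carrier >] }.

HB.instance Definition _ := [isSub for carrier].
HB.instance Definition _ := [Choice of TT by <:].

Lemma TTP (J : TT) : in_TT J.
Proof. by case: J => J /= J_T; apply/asboolP. Qed.

Definition ordz (J : set int) : int :=
  (cardz (J `\` Zle 0))%:Z - (cardz (Zle 0 `\` J))%:Z.

(* [elt J i] is j_{-i}, where J = {... < j_{-2} < j_{-1} < j_0}. *)
Fixpoint elt (J : set int) (i : nat) : int :=
  if i is i'.+1 then maxz [set x | J x /\ x < elt J i'] else maxz J.

Definition bounded (n : nat) (J : set int) : Prop :=
  forall i : nat, elt J i - elt J i.+1 <= n%:Z.

Definition stable (n : nat) (J : set int) : Prop :=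
  forall j : int, J j -> J (j - n%:Z).

(* C(L_m), with L_m = Zle m. *)
Definition CL (n : nat) (m : int) : set TT :=
  [set J | ordz J = m /\ bounded n J].

(* K < J lexicographically; the index N <= 0 of j_N is encoded as - N. *)
Definition lexlt (K J : set int) : Prop :=
  exists N : nat, elt K N < elt J N /\
    forall i : nat, (N < i)%N -> elt K i = elt J i.
Definition lexle (K J : TT) : Prop := lexlt K J \/ K = J.

Lemma in_TT_exch (J : TT) (p q : int) : `[< in_TT ((J `\ p) `|` [set q]) >].
Proof.
apply/asboolP; case: (TTP J) => f1 f2; split.
  apply: (@sub_finite_set _ _ ((J `\` Zle 0) `|` [set q])).
    by move=> x [[[Jx _]|->] nx]; [left|right].
  by rewrite finite_setU; split => //; exact: finite_set1.
apply: (@sub_finite_set _ _ ((Zle 0 `\` J) `|` [set p])).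
  move=> x [x0 nx]; case: (pselect (x = p)) => [->|xp]; first by right.
  by left; split => // Jx; apply: nx; left; split.
by rewrite finite_setU; split => //; exact: finite_set1.
Qed.

Definition exch (J : TT) (p q : int) : TT := MkTT (in_TT_exch J p q).

(* p and q in up(J) = J \ p \cup q; only meaningful for J bounded, not stable. *)
Definition upp (n : nat) (J : set int) : int :=
  maxz [set p | J p /\ ~ J (p - n%:Z)].
Definition upq (n : nat) (J : set int) : int :=
  minz [set q | [/\ upp n J < q, ~ J q, J (q - n%:Z)
                  & ~ (q = upp n J %[mod n%:Z])%Z ]].
Definition up (n : nat) (J : TT) : TT := exch J (upp n J) (upq n J).

(* The number of steps needed to reach a stable set; it exists for bounded J
   and n >= 2, and is 0 by convention if a stable set is never reached. *)
Definition ell (n : nat) (J : TT) : nat :=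
  xget 0%N [set l | stable n (iter l (up n) J) /\
                    forall i : nat, (i < l)%N -> ~ stable n (iter i (up n) J)].

Definition roof (n : nat) (J : TT) : TT := iter (ell n J) (up n) J.

(* up^i(J) = up^(i-1)(J) \ p_i \cup q_i, for i >= 1. *)
Definition pstep (n : nat) (J : TT) (i : nat) : int := upp n (iter i.-1 (up n) J).
Definition qstep (n : nat) (J : TT) (i : nat) : int := upq n (iter i.-1 (up n) J).

Section Fock.
Variable R : realType.

Definition Fock := {freeg TT / R[i]}.

Definition eps (J : TT) : Fock := << J >>.

Definition coef (v : Fock) (K : TT) : R[i] := coeff K v.

Definition E'_basis (i j : int) (J : TT) : Fock :=
  if `[< (J : set int) j /\ ~ (J : set int) i >]
  then (-1) ^+ (cardz (J `&` [set x | i <= x <= j]) - 1) *: eps (exch J j i)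
  else 0.

(* Linear extension; used for i < j only. *)
Definition E' (i j : int) (v : Fock) : Fock := fglift (E'_basis i j) v.

(* The sum has finitely many nonzero terms, see [Ehat_finite]. *)
Definition Ehat (n : nat) (p q : int) (v : Fock) : Fock :=
  \sum_(k \in [set: int]) E' (p + n%:Z * k) (q + n%:Z * k) v.

Lemma Ehat_finite (n : nat) (p q : int) (v : Fock) : (0 < n)%N ->
  finite_set [set k : int | E' (p + n%:Z * k) (q + n%:Z * k) v != 0].
Proof.
move=> n0.
have injn (c : int) : injective (fun k : int => c + n%:Z * k).
  by move=> k k' /addrI /mulfI; apply; rewrite eqz_nat -lt0n.
pose S (J : TT) := [set k : int | E'_basis (p + n%:Z * k) (q + n%:Z * k) J != 0].
have finS J : finite_set (S J).
  case: (TTP J) => f1 f2.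
  pose N : nat := (absz p + absz q)%N.
  pose I := [set - N%:Z + i%:Z | i in `I_(N + N).+1].
  apply: (@sub_finite_set _ _ ((fun k => q + n%:Z * k) @^-1` (J `\` Zle 0) `|`
     (fun k => p + n%:Z * k) @^-1` (Zle 0 `\` J) `|` I)).
    move=> k; rewrite /S /= /E'_basis; case: ifPn; last by rewrite eqxx.
    move=> /asboolP[Jq Jp] _.
    case: (pselect (q + n%:Z * k <= 0)) => [q0|q0]; last by left; left; split.
    case: (pselect (p + n%:Z * k <= 0)) => [p0|p0]; first by left; right; split.
    right; rewrite /I /=; exists (absz (N%:Z + k)).
      by rewrite /= /N; nia.
    by rewrite /N; nia.
  rewrite !finite_setU; split; first split.
  - by apply: finite_preimage => // x y _ _; exact: injn.
  - by apply: finite_preimage => // x y _ _; exact: injn.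
  - by apply: finite_image; exact: finite_II.
apply: (@sub_finite_set _ _ (\bigcup_(J in [set` dom v]) S J)); last first.
  by apply: bigcup_finite => //; exact: finite_seq.
move=> k; rewrite /= /E' -[v]Freeg_dom fglift_Freeg /prelift big_map Freeg_dom => nz.
apply: contrapT => nJ; move/eqP: nz; apply; rewrite big_seq big1 // => J Jv /=.
case: (eqVneq (E'_basis (p + n%:Z * k) (q + n%:Z * k) J) 0) => [->|nz].
  exact: scaler0.
by exfalso; apply: nJ; exists J.
Qed.

Definition vvec (n : nat) (J : TT) : Fock :=
  foldr (fun i w => Ehat n (pstep n J i) (qstep n J i) w)
        (eps (roof n J)) (iota 1 (ell n J)).

(* acoef n J K is a_K^J. *)
Definition acoef (n : nat) (J K : TT) : R[i] := coef (vvec n J) K.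

End Fock.

(* The maximal t <= l with p_1 = ... = p_t mod n. *)
Definition tmax (n : nat) (J : TT) : nat :=
  \max_(t < (ell n J).+1 |
        all (fun i => (pstep n J i == pstep n J 1 %[mod n%:Z])%Z) (iota 1 t)) t.

Definition mu (n : nat) (J : TT) (d : nat) : nat :=
  count (fun i => qstep n J i - pstep n J i == d%:Z) (iota 1 (tmax n J)).

(* Finitely many factors differ from 1. *)
Definition prod_mu (n : nat) (J : TT) : nat :=
  \big[muln/1%N]_(d \in [set d : nat | (1 <= d)%N]) (mu n J d)`!.

Definition Jtilde (n : nat) (J : TT) : TT := iter (tmax n J) (up n) J.

(* Main.v *)
Require Import Defs.
From mathcomp Require Import all_boot all_order all_algebra.
From mathcomp Require Import finmap boolp classical_sets.
From mathcomp Require Import cardinality fsbigop reals.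
From mathcomp Require Import complex.
From mathcomp Require Import freeg.
From mathcomp Require Import zify ring.

Set Implicit Arguments.
Unset Strict Implicit.
Unset Printing Implicit Defensive.

Import Order.TTheory GRing.Theory Num.Theory.
Local Open Scope ring_scope.

(** Think of [J] as particles on [n] runners, the residue classes modulo [n].
    A raising step takes the highest particle [p] that has a hole [n] below it
    and moves it by some stride [d] onto another runner; [Ehat n p (p + d)]
    sums, with signs, the reverse hops on all translates by multiples of [n].
    Everything is computed on coefficients, where a sum acts through its
    transpose: the coefficient of [K] in [Ehat n p (p + d) v] is the signed sum
    of the coefficients in [v] of the sets obtained from [K] by moving one
    particle on the runner of [p] up by [d] ([coef_E'], [coef_Ehat]).

    For the triangularity, note that all sets occurring in [vvec n J] agree
    with [J] in order, in the population of every runner and in energy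
    ([conserved]).  Above [p], the runners of [J], and those of [up n J], are
    flush, so these sets have the least energy compatible with their part up
    to [p] and their populations: a set of the support that agrees with one of
    them up to [p] equals it ([flush_unique]).  Inductively a set [K] of the
    support comes by one hop from some [K'] that does not exceed [up n J].
    Either this already shows [K] to contain a position below [p] that is free
    in [J], before any other difference, or [K] agrees with [J] up to [p] and
    equals it ([vvec_support]).

    For the diagonal coefficient, the first steps raise one after the other
    the particles of the block [p], [p + n], [p + 2n], and so on, up to its
    end, with weakly decreasing strides.  The corresponding sums commute, and
    in the coefficient of [J] exactly one of them has to put a particle at [p]
    ([fill]): a product of hops avoiding [p] would empty a position below the
    block, which the triangularity for the set that remains after these steps
    rules out ([block_dead_end]).  A sum with a stride shorter than the first
    one cannot do it, since its hop would end at a particle of [J]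
    ([block_short_stride]); those with the first stride do it, all with the
    same contribution.  Hence one raising step costs a sign and a factor,
    the number of steps of the block that share its stride
    ([block_coefficient]).  As long as the steps stay on the same runner, later
    blocks never use the stride again ([later_stride_neq]), so along such a run
    the factors of the steps of stride [d] are mu_d, mu_d - 1, ..., 1, with
    product the factorial of mu_d ([suffix_multE], [diagonal_run]). *)

(** * Membership and extremal elements *)

Canonical TT_predType := PredType (fun (J : TT) (x : int) => `[< carrier J x >]).

Lemma inP (J : TT) x : reflect (carrier J x) (x \in J).
Proof. exact: asboolP. Qed.

Lemma TT_ext (J K : TT) : J =i K -> J = K.
Proof.
move=> eJK; apply: val_inj; apply/funext => x; apply/propext.
by split=> /inP; rewrite ?eJK => h; apply/inP; rewrite ?eJK // -eJK.
Qed.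

Lemma in_exch (J : TT) p q x :
  (x \in exch J p q) = (x \in J) && (x != p) || (x == q).
Proof.
apply/inP/orP => /= [[[Jx /eqP xp]|/= ->]|[/andP[/inP Jx /eqP xp]|/eqP ->]].
- by left; rewrite xp andbT; apply/inP.
- by right.
- by left; split.
- by right.
Qed.

Lemma TT_bounds (J : TT) : exists N : nat,
  forall x, (x <= - N%:Z -> x \in J) /\ (N%:Z < x -> x \notin J).
Proof.
have [/finite_seqP[s1 h1] /finite_seqP[s2 h2]] := TTP J.
exists (\max_(x <- s1 ++ s2) `|x|%N).+1 => x.
have bnd y : y \in s1 ++ s2 -> (`|y| <= \max_(x <- s1 ++ s2) `|x|)%N.
  by move=> ys; apply: leq_bigmax_seq.
split=> hx.
  apply: contraT => /inP nJx.
  have /= : [set` s2]%classic x by rewrite -h2; split=> //=; rewrite /Zle /=; lia.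
  by move=> xs; have := bnd x; rewrite mem_cat xs orbT => /(_ isT); lia.
apply/negP => /inP Jx.
have /= : [set` s1]%classic x by rewrite -h1; split=> //=; rewrite /Zle /=; lia.
by move=> xs; have := bnd x; rewrite mem_cat xs => /(_ isT); lia.
Qed.

Lemma maxzP (A : set int) (N : int) x0 : A x0 -> (forall x, A x -> x <= N) ->
  A (maxz A) /\ forall y, A y -> y <= maxz A.
Proof.
move=> Ax0 AN.
suff ex : exists m, A m /\ forall y, A y -> y <= m by have := xgetPex 0 ex.
have exk : exists k : nat, `[< A (N - k%:Z) >].
  exists `|N - x0|%N; apply/asboolP.
  by rewrite (_ : N - _ = x0) //; have := AN _ Ax0; lia.
case: (ex_minnP exk) => k /asboolP Ak kmin; exists (N - k%:Z); split=> // y Ay.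
have := kmin `|N - y|%N; have yN := AN _ Ay.
rewrite (_ : N - `|N - y|%N%:Z = y); last lia.
by move/asboolP: Ay => -> /(_ isT); lia.
Qed.

Lemma minzP (A : set int) (N : int) x0 : A x0 -> (forall x, A x -> N <= x) ->
  A (minz A) /\ forall y, A y -> minz A <= y.
Proof.
move=> Ax0 AN.
suff ex : exists m, A m /\ forall y, A y -> m <= y by have := xgetPex 0 ex.
have exk : exists k : nat, `[< A (N + k%:Z) >].
  exists `|x0 - N|%N; apply/asboolP.
  by rewrite (_ : N + _ = x0) //; have := AN _ Ax0; lia.
case: (ex_minnP exk) => k /asboolP Ak kmin; exists (N + k%:Z); split=> // y Ay.
have := kmin `|y - N|%N; have yN := AN _ Ay.
rewrite (_ : N + `|y - N|%N%:Z = y); last lia.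
by move/asboolP: Ay => -> /(_ isT); lia.
Qed.

Lemma maxz_eq (A : set int) m : A m -> (forall x, A x -> x <= m) -> maxz A = m.
Proof.
move=> Am Amax; have [Ax Axmax] := maxzP Am Amax.
by apply/eqP; rewrite eq_le Axmax // Amax.
Qed.

(** * Enumeration in decreasing order *)

Lemma TT_below (J : TT) (b : int) : exists2 y, y \in J & y < b.
Proof.
have [N hN] := TT_bounds J.
exists (- N%:Z - `|b| - 1); last lia.
by have [h _] := hN (- N%:Z - `|b| - 1); apply: h; lia.
Qed.

Lemma elt0P (J : TT) : elt J 0 \in J /\ forall y, y \in J -> y <= elt J 0.
Proof.
have [N hN] := TT_bounds J; have [y0 Jy0 _] := TT_below J 0.
have [||h1 h2] := @maxzP (carrier J) N%:Z y0; first exact/inP.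
  move=> x /inP Jx; rewrite leNgt; apply/negP => Nx.
  by have [_ /(_ Nx)] := hN x; rewrite Jx.
by split; [exact/inP | move=> y /inP; exact: h2].
Qed.

Lemma eltSP (J : TT) i : [/\ elt J i.+1 \in J, elt J i.+1 < elt J i &
  forall y, y \in J -> y < elt J i -> y <= elt J i.+1].
Proof.
have [y0 Jy0 y0i] := TT_below J (elt J i).
have [||[h1 h1'] h2] := @maxzP [set x | carrier J x /\ x < elt J i]%classic
  (elt J i) y0; first by split=> //; exact/inP.
  by move=> x /= [_]; lia.
by split=> //; [exact/inP | move=> y /inP Jy yi; exact: h2].
Qed.

Lemma elt_in (J : TT) i : elt J i \in J.
Proof. by case: i => [|i]; [case: (elt0P J) | case: (eltSP J i)]. Qed.

Lemma elt_le (J : TT) i : elt J i <= elt J 0 - i%:Z.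
Proof. by elim: i => [|i IH]; [lia | have [_ + _] := eltSP J i; lia]. Qed.

Lemma elt_count (J : TT) (b : int) : exists2 N : nat,
  elt J N <= b & forall i, (i < N)%N -> b < elt J i.
Proof.
have exN : exists N, elt J N <= b.
  by exists `|elt J 0 - b|%N; have := elt_le J `|elt J 0 - b|%N; lia.
exists (ex_minn exN); case: (ex_minnP exN) => // N _ Nmin i iN.
by rewrite ltNge; apply/negP => /Nmin; rewrite leqNgt iN.
Qed.

Lemma elt_onto (J : TT) x : x \in J -> exists i, elt J i = x.
Proof.
move=> Jx; have [N Nx Nmin] := elt_count J x; exists N.
apply/eqP; rewrite eq_le Nx /=; case: N {Nx} Nmin => [|N] Nmin.
  by have [_ ->] := elt0P J.
by have [_ _ ->] := eltSP J N => //; exact: Nmin.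
Qed.

(** * Congruences, flush sets and the raising step *)

Lemma congP (n : nat) (x y : int) :
  reflect (exists k : int, x = y + n%:Z * k) (x == y %[mod n%:Z])%Z.
Proof.
rewrite eqz_mod_dvd; apply: (iffP dvdzP) => -[k hk]; exists k.
  by rewrite mulrC -hk; lia.
by rewrite hk; lia.
Qed.

(** The form in which [n]-boundedness is used, and is inherited by [up]. *)
Definition gap_le (n : nat) (J : TT) : Prop :=
  forall x, x \in J -> exists2 y, y \in J & x - n%:Z <= y < x.

Lemma gap_le_bounded n (J : TT) : bounded n J -> gap_le n J.
Proof.
move=> bJ x /elt_onto[i <-]; exists (elt J i.+1); first exact: elt_in.
by have [_ ? _] := eltSP J i; have := bJ i; lia.
Qed.

(** Above [p], each runner (residue class mod [n]) of [J] is a block starting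
    at the lowest position beyond [p]. *)
Definition flush_above (n : nat) (p : int) (J : TT) : Prop :=
  forall x, x \in J -> p < x - n%:Z -> x - n%:Z \in J.

Lemma flush_above_sub n p J x k : (0 < n)%N -> flush_above n p J ->
  x + n%:Z * k \in J -> p < x -> 0 <= k -> x \in J.
Proof.
move=> n0 fJ + px; case: k => // k + _; elim: k => [|k IH]; first by rewrite mulr0 addr0.
move=> h; apply: IH; have -> : x + n%:Z * k = x + n%:Z * k.+1 - n%:Z by lia.
by apply: fJ => //; nia.
Qed.

Lemma stableP n (J : TT) :
  stable n J <-> forall x, x \in J -> x - n%:Z \in J.
Proof. by split=> h x; [move/inP/h/inP | move/inP/h/inP]. Qed.

Lemma uppP n (J : TT) : ~ stable n J ->
  [/\ upp n J \in J, upp n J - n%:Z \notin J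
    & forall x, x \in J -> upp n J < x -> x - n%:Z \in J].
Proof.
move=> nst; have [N hN] := TT_bounds J.
have [x0 [Jx0 nJx0]] : exists x0, carrier J x0 /\ ~ carrier J (x0 - n%:Z).
  apply: contrapT => nex; apply: nst => x Jx; apply: contrapT => nJx.
  by apply: nex; exists x.
have [||[h1 h2] h3] := @maxzP [set p | carrier J p /\ ~ carrier J (p - n%:Z)]%classic
  N%:Z x0; first by split.
  move=> x /= [/inP Jx _]; rewrite leNgt; apply/negP => Nx.
  by have [_ /(_ Nx)] := hN x; rewrite Jx.
split; [exact/inP | exact/inP | move=> x Jx px].
apply: contraT => /inP nJx.
by have := h3 x; rewrite /= leNgt px => /(_ (conj (inP _ _ Jx) nJx)).
Qed.

Lemma upp_eq n (J : TT) p : p \in J -> p - n%:Z \notin J ->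
  (forall x, x \in J -> p < x -> x - n%:Z \in J) -> upp n J = p /\ ~ stable n J.
Proof.
move=> Jp nJp Jmax; split; last by move/stableP/(_ _ Jp); rewrite (negPf nJp).
apply: maxz_eq; first by split; exact/inP.
move=> x [/inP Jx /inP nJx]; rewrite leNgt; apply/negP => px.
by rewrite Jmax in nJx.
Qed.

Section Up.
Variables (n : nat) (J : TT).
Hypotheses (n0 : (0 < n)%N) (gJ : gap_le n J) (nst : ~ stable n J).
Let p := upp n J.
Let q := upq n J.

Lemma upqP : [/\ p < q, q \notin J, q - n%:Z \in J, (q != p %[mod n%:Z])%Z
  & forall x, p < x -> x \notin J -> x - n%:Z \in J -> (x != p %[mod n%:Z])%Z ->
      q <= x].
Proof.
have [Jp nJp pmax] := uppP nst; have [N hN] := TT_bounds J.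
pose A := [set q | [/\ p < q, ~ carrier J q, carrier J (q - n%:Z)
                  & ~ (q = p %[mod n%:Z])%Z ]]%classic.
have Aeq x : p < x -> x \notin J -> x - n%:Z \in J -> (x != p %[mod n%:Z])%Z -> A x.
  by move=> ? ? ? ?; split=> //; [exact/inP|exact/inP|exact/eqP].
(* A candidate exists: an element strictly between p - n and p lies on another
   runner, and the first hole above it on that runner qualifies. *)
have [y Jy /andP[ylo yhi]] := gJ Jp.
have yp : p - n%:Z < y.
  by rewrite lt_neqAle ylo andbT; apply/negP => /eqP yE; rewrite yE Jy in nJp.
have exk : exists k : nat, y + n%:Z * k.+1%:Z \notin J.
  by exists (`|y| + N)%N; apply: (hN _).2; nia.
have [k nJk kmin] := ex_minnP exk.
have Jk : y + n%:Z * k \in J.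
  case: k {nJk} kmin => [|k] kmin; first by rewrite mulr0 addr0.
  by apply: contraT => /kmin; rewrite ltnn.
have Ay : A (y + n%:Z * k.+1%:Z).
  apply: Aeq => //; first by nia.
    by rewrite (_ : _ - _ = y + n%:Z * k) //; lia.
  by apply/negP => /congP[l hl]; have : 0 < k.+1%:Z - l < 1; nia.
have [|[q1 q2 q3 q4] qmin] := @minzP A p _ Ay; first by move=> x []; lia.
split=> //; [exact/inP | exact/inP | exact/eqP | move=> x ? ? ? ?].
exact/qmin/Aeq.
Qed.

Lemma in_up x : (x \in up n J) = (x \in J) && (x != p) || (x == q).
Proof. exact: in_exch. Qed.

(** The element [n] below remains a witness, unless it is the one that left. *)
Lemma up_gap_le : gap_le n (up n J).
Proof.
have [Jp nJp pmax] := uppP nst; have [pq nJq Jq qp qmin] := upqP.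
have pick x y : x != y -> y \in J -> x - n%:Z <= y < x -> y != p ->
   exists2 y, y \in up n J & x - n%:Z <= y < x.
  by move=> _ Jy yx yp; exists y => //; rewrite in_up Jy yp.
have down x : x - n%:Z \in J -> x - n%:Z != p ->
   exists2 y, y \in up n J & x - n%:Z <= y < x.
  by move=> Jx xp; exists (x - n%:Z); [rewrite in_up Jx xp | lia].
move=> x; rewrite in_up => /orP[/andP[Jx xp]|/eqP->]; last first.
  by apply: down => //; apply: contraNneq qp => qE; apply/congP; exists 1; lia.
have [xp'|px] := ltP x p.
  have [y Jy yx] := gJ Jx; exists y => //; rewrite in_up Jy /=.
  by have -> : y != p by lia.
have {xp} px : p < x by rewrite lt_neqAle eq_sym xp.
have Jxn := pmax _ Jx px.
have [xnp|] := eqVneq (x - n%:Z) p; last exact: down.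
(* The element x = p + n has lost p; the runner of the predecessor of p then
   offers either an element of J or the new element q. *)
have [y Jy /andP[ylo yhi]] := gJ Jp.
have yp : p - n%:Z < y.
  by rewrite lt_neqAle ylo andbT; apply/negP => /eqP yE; rewrite yE Jy in nJp.
have [Jyn|nJyn] := boolP (y + n%:Z \in J).
  by exists (y + n%:Z); [rewrite in_up Jyn /=; have -> : y + n%:Z != p by lia | lia].
exists q; first by rewrite in_up eqxx orbT.
have : q <= y + n%:Z; last lia.
apply: qmin => //; [lia | by rewrite addrK |].
by apply/negP => /congP[l hl]; have : 0 < 1 - l < 1; nia.
Qed.

Lemma up_flush : flush_above n p (up n J).
Proof.
have [Jp nJp pmax] := uppP nst; have [pq nJq Jq qp qmin] := upqP.
move=> x; rewrite !in_up => /orP[/andP[Jx _]|/eqP->] px.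
  by rewrite pmax //=; [have -> : x - n%:Z != p by lia | lia].
by rewrite Jq /=; have -> : q - n%:Z != p by lia.
Qed.

Lemma upp_flush : flush_above n p J.
Proof. by have [_ _ pmax] := uppP nst; move=> x Jx px; apply: pmax => //; lia. Qed.

End Up.

(** * Lexicographic precedence and conserved quantities *)

(** The lexicographic order, read off the lowest position where two sets
    differ; this reading presupposes sets of equal order. *)
Definition precedes (K J : TT) : Prop :=
  K = J \/ exists x, [/\ x \in K, x \notin J &
                        forall y, y < x -> (y \in K) = (y \in J)].

Lemma precedesN (K J : TT) z : z \in J -> z \notin K ->
  (forall y, y < z -> (y \in K) = (y \in J)) -> ~ precedes K J.
Proof.
move=> Jz nKz eKJ [KJ|[x [Kx nJx eKJx]]]; first by rewrite KJ Jz in nKz.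
have [xz|zx|xz] := ltgtP x z; last by rewrite xz Jz in nJx.
  by rewrite eKJ // (negPf nJx) in Kx.
by rewrite eKJx // Jz in nKz.
Qed.

Definition quasi_periodic (n : nat) (f : int -> int) : Prop :=
  forall x y k, f (x + n%:Z * k) - f x = f (y + n%:Z * k) - f y.

(** [K] and [J] carry the same total of every quasi-periodic weight: constant
    weights give the order, indicators of residues the population of each
    runner, the identity the energy.  The totals being infinite, the two
    sets are compared through multisets of particles that make up for their
    difference. *)
Definition conserved (n : nat) (K J : TT) : Prop :=
  exists ks js : seq int,
    (forall x, ((x \in K) + count_mem x js = (x \in J) + count_mem x ks)%N) /\
    forall f, quasi_periodic n f -> \sum_(x <- ks) f x = \sum_(x <- js) f x.

Lemma conserved_refl n J : conserved n J J.
Proof. by exists [::], [::]. Qed.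

Lemma exch_count (K : TT) a b x : a \in K -> b \notin K ->
  ((x \in exch K a b) + (x == a) = (x \in K) + (x == b))%N.
Proof.
move=> Ka nKb; rewrite in_exch.
have [->|xa] := eqVneq x a; last first.
  rewrite andbT; have [->|] := eqVneq x b; last by rewrite orbF.
  by rewrite (negPf nKb).
by rewrite Ka; have -> : a == b = false by apply/negP => /eqP ab; rewrite -ab Ka in nKb.
Qed.

(** Translating a hop by a multiple of [n] does not change its effect on a
    quasi-periodic total. *)
Lemma conserved_hop n (K J : TT) (p q k : int) : conserved n K J ->
  p + n%:Z * k \notin K -> q + n%:Z * k \in K -> p \notin J -> q \in J ->
  conserved n (exch K (q + n%:Z * k) (p + n%:Z * k)) (exch J q p).
Proof.
move=> [ks [js [eKJ eq_w]]] nKp Kq nJp Jq.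
exists (p + n%:Z * k :: q :: ks), (q + n%:Z * k :: p :: js); split=> [x|f qf].
  have cm a l : count_mem x (a :: l) = ((x == a) + count_mem x l)%N.
    by rewrite /= eq_sym.
  have := exch_count x Kq nKp; have := exch_count x Jq nJp; have := eKJ x.
  by rewrite !cm; do 8!move: (nat_of_bool _) => ?; lia.
have arith (a b c d e : int) : a - b = c - d -> a + (d + e) = c + (b + e) by lia.
by rewrite !big_cons (eq_w f qf); apply/arith/qf.
Qed.

Lemma sum_count (l u : seq int) (f : int -> int) : uniq u -> {subset l <= u} ->
  \sum_(x <- l) f x = \sum_(x <- u) (count_mem x l)%:Z * f x.
Proof.
move=> uu; elim: l => [|y l IH] sub.
  by rewrite big_nil big1 //= => x _; rewrite mul0r.
rewrite big_cons IH; last by move=> x xl; apply: sub; rewrite inE xl orbT.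
have yu : y \in u by apply: sub; exact: mem_head.
rewrite (bigD1_seq y yu uu) [in RHS](bigD1_seq y yu uu) /= eqxx addrA.
rewrite PoszD mulrDl mul1r; congr (_ + _).
by apply: eq_bigr => x /negPf xy; rewrite eq_sym xy.
Qed.

Lemma conserved_weight n (K J : TT) f (s : seq int) : conserved n K J ->
  quasi_periodic n f ->
  exists2 u, uniq u & [/\ {subset s <= u},
    (forall x, x \notin u -> (x \in K) = (x \in J)) &
    \sum_(x <- u) ((x \in K)%:Z - (x \in J)%:Z) * f x = 0].
Proof.
move=> [ks [js [eKJ eq_w]]] qf.
exists (undup (ks ++ js ++ s)); first exact: undup_uniq.
split.
- by move=> x xs; rewrite mem_undup !mem_cat xs !orbT.
- move=> x; rewrite mem_undup !mem_cat !negb_or => /and3P[xk xj _].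
  have := eKJ x; rewrite (count_memPn xk) (count_memPn xj) !addn0.
  by case: (x \in K); case: (x \in J).
have := eq_w f qf; set u := undup _.
rewrite (@sum_count ks u) ?undup_uniq //; last first.
  by move=> x xs; rewrite mem_undup !mem_cat xs.
rewrite (@sum_count js u) ?undup_uniq //; last first.
  by move=> x xs; rewrite mem_undup !mem_cat xs orbT.
move/eqP; rewrite -subr_eq0 -sumrB => /eqP h; rewrite -[RHS]h; apply: eq_bigr => x _.
have arith (a b c d : nat) : (a + d = b + c)%N -> a%:Z - b%:Z = c%:Z - d%:Z by lia.
by rewrite -mulrBl; congr (_ * _); apply/arith/eKJ.
Qed.

(** Among all sets with the same conserved quantities and the same part up to
    [p], a flush one has its particles above [p] as low as possible.  The
    weight used here is negative exactly on its occupied positions above [p]: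
    any discrepancy would make the total positive. *)
Lemma flush_unique n p (K J : TT) : (0 < n)%N -> flush_above n p J ->
  conserved n K J -> (forall x, x <= p -> (x \in K) = (x \in J)) -> K = J.
Proof.
move=> n0 fJ cKJ eKJ.
(* The lowest unoccupied position above p on the runner of x. *)
pose c x := minz [set z | [/\ p < z, ~ carrier J z & (z == x %[mod n%:Z])%Z]]%classic.
have cP x : [/\ p < c x, c x \notin J, (c x == x %[mod n%:Z])%Z &
    forall z, p < z -> z \notin J -> (z == x %[mod n%:Z])%Z -> c x <= z].
  have [N hN] := TT_bounds J.
  have Ax : [set z | [/\ p < z, ~ carrier J z & (z == x %[mod n%:Z])%Z]]%classic
     (x + n%:Z * (`|x| + `|p| + N).+1%:Z).
    split; first by nia.
      by apply/inP/(hN _).2; nia.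
    by apply/congP; eexists.
  have [|[h1 h2 h3] h4] := @minzP _ p _ Ax; first by move=> z []; lia.
  by split=> //; [exact/inP | move=> z pz /inP Jz zx; exact: h4].
have c_per x k : c (x + n%:Z * k) = c x.
  congr minz; apply/funext => z; apply/propext; rewrite /=.
  have -> // : ((x + n%:Z * k) %% n%:Z = x %% n%:Z)%Z.
  by apply/eqP/congP; exists k.
pose f x := 2 * (x - c x) + n%:Z.
have qf : quasi_periodic n f by move=> x y k; rewrite /f !c_per; lia.
have [u uu [_ eqN sum0]] := conserved_weight [::] cKJ qf.
have f_out x : p < x -> x \notin J -> 0 < f x.
  by move=> px nJx; have [_ _ _ /(_ x px nJx (eqxx _))] := cP x; rewrite /f; lia.
have f_in x : p < x -> x \in J -> f x < 0.
  move=> px Jx; have [pc nJc /congP[k hk] _] := cP x.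
  have : k > 0; last by rewrite /f; nia.
  rewrite ltNge; apply/negP => k0.
  have Jx' : c x + n%:Z * (- k) \in J by rewrite hk mulrN addrK.
  by have := flush_above_sub n0 fJ Jx' pc; rewrite (negPf nJc) => h; have := h _; lia.
have term_ge0 x : 0 <= ((x \in K)%:Z - (x \in J)%:Z) * f x.
  have [xp|px] := leP x p; first by rewrite eKJ // subrr mul0r.
  have := f_out x px; have := f_in x px.
  by case: (x \in K); case: (x \in J) => /= h1 h2; rewrite ?subrr ?mul0r //;
     [have := h2 isT | have := h1 isT]; lia.
apply: TT_ext => x; have [xu|/eqN //] := boolP (x \in u).
have [xp|px] := leP x p; first exact: eKJ.
move/eqP: sum0; rewrite psumr_eq0 // => /allP/(_ x xu) /=.
have := f_out x px; have := f_in x px.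
by case: (x \in K); case: (x \in J) => //= h1 h2 /eqP;
   [have := h2 isT | have := h1 isT]; lia.
Qed.

(** * Hops and their signs *)

Definition span_card (K : TT) (x y : int) : nat :=
  cardz (carrier K `&` [set z | x <= z <= y])%classic.

Lemma cardz_count (A : set int) (P : pred int) (s : seq int) : uniq s ->
  (forall z, A z -> z \in s) -> (forall z, z \in s -> P z <-> A z) ->
  cardz A = count P s.
Proof.
move=> us As PA; rewrite /cardz -size_filter; apply: perm_size.
have fA : finite_set A by apply: (@sub_finite_set _ _ [set` s]%classic).
apply: uniq_perm; rewrite ?filter_uniq // => z.
rewrite mem_filter in_fset_set //; apply/idP/andP => [/set_mem Az|[Pz zs]].
  by split; [apply/(PA _ (As _ Az)) | exact: As].
by apply/mem_set/(PA _ zs).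
Qed.

Definition zrange (x y : int) : seq int := [seq x + i%:Z | i <- iota 0 `|y - x|.+1].

Lemma zrange_uniq x y : uniq (zrange x y).
Proof. by rewrite map_inj_uniq ?iota_uniq // => i j /addrI []. Qed.

Lemma mem_zrange x y z : x <= y -> (z \in zrange x y) = (x <= z <= y).
Proof.
move=> xy; apply/mapP/idP => [[i + ->] | xzy]; first by rewrite mem_iota; lia.
by exists `|z - x|%N; [rewrite mem_iota; lia | lia].
Qed.

Lemma span_cardE K x y : x <= y ->
  span_card K x y = (\sum_(z <- zrange x y) (z \in K))%N.
Proof.
move=> xy; rewrite /span_card (@cardz_count _ [pred z | z \in K] _ (zrange_uniq x y)).
- by rewrite -sum1_count big_mkcond.
- by move=> z [_ /= h]; rewrite mem_zrange.
- move=> z; rewrite mem_zrange //= => h.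
  by split=> [/inP Kz| [/inP Kz _]].
Qed.

Lemma span_card_gt0 (K : TT) x y : x <= y -> x \in K -> (0 < span_card K x y)%N.
Proof.
move=> xy Kx; rewrite span_cardE // (bigD1_seq x) ?zrange_uniq ?mem_zrange //=.
  by rewrite Kx.
by rewrite xy lexx.
Qed.

Lemma span_exch (K : TT) a b x y : x <= y -> a \in K -> b \notin K ->
  (span_card (exch K a b) x y + (x <= a <= y)%R = span_card K x y + (x <= b <= y)%R)%N.
Proof.
move=> xy Ka nKb; rewrite !span_cardE //.
have oneE c : (\sum_(z <- zrange x y) (z == c))%N = (x <= c <= y).
  rewrite -mem_zrange //; have [h|h] := boolP (c \in zrange x y); last first.
    by rewrite big_seq big1 // => z zr; case: eqP => // zc; rewrite -zc zr in h.
  by rewrite (bigD1_seq c) ?zrange_uniq //= eqxx big1 // => z /negPf ->.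
rewrite -2!oneE -!big_split; apply: eq_bigr => z _; exact: exch_count.
Qed.

Section Hop.
Variable C : comNzRingType.
Implicit Types (f g : TT -> C) (K : TT).

(** The transpose of [E'] : the coefficient of [K] in [E' x y v] is
    [hop x y f K], where [f] lists the coefficients of [v]. *)
Definition hop (x y : int) f K : C :=
  if (x \in K) && (y \notin K)
  then (-1) ^+ (span_card K x y - 1) * f (exch K x y) else 0.

Lemma hop0 x y f K : ~~ ((x \in K) && (y \notin K)) -> hop x y f K = 0.
Proof. by rewrite /hop => /negPf ->. Qed.

Lemma eq_hop x y f g K :
  (x \in K -> y \notin K -> f (exch K x y) = g (exch K x y)) ->
  hop x y f K = hop x y g K.
Proof. by rewrite /hop; case: ifP => // /andP[Kx nKy] ->. Qed.

Lemma hop_sum x y (I : Type) (r : seq I) (P : pred I) (f : I -> TT -> C) K :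
  hop x y (fun L => \sum_(i <- r | P i) f i L) K = \sum_(i <- r | P i) hop x y (f i) K.
Proof.
rewrite /hop; case: ifP => _; first exact: mulr_sumr.
by rewrite big1.
Qed.

Lemma exchC K a b c d : a != c -> a != d -> b != c -> b != d ->
  exch (exch K a b) c d = exch (exch K c d) a b.
Proof.
move=> ac ad bc bd; apply: TT_ext => z; rewrite !in_exch.
have [->|zb] := eqVneq z b; first by rewrite (negPf bd) bc !orbT.
rewrite !orbF; have [->|zd] := eqVneq z d; first by rewrite (eq_sym d) ad !orbT.
by rewrite !orbF -!andbA [(_ != a) && _]andbC.
Qed.

(** The interval between the ends of one hop separates those of another one
    if and only if the converse holds: the signs agree. *)
Lemma hopC x y x' y' f K : x < y -> x' < y' -> x != x' -> x != y' -> x' != y ->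
  hop x y (hop x' y' f) K = hop x' y' (hop x y f) K.
Proof.
move=> xy x'y' xx' xy' x'y.
(* Two hops cannot end at the same place. *)
have [<-|yy'] := eqVneq y y'.
  by rewrite /hop !in_exch eqxx !orbT !andbF !mulr0; do 2!case: ifP.
rewrite /hop !in_exch [x' == x]eq_sym [y' == x]eq_sym [y' == y]eq_sym.
rewrite (negPf xx') (negPf xy') (negPf x'y) (negPf yy') [y == x']eq_sym (negPf x'y) /= !andbT !orbF.
case: (boolP ((x \in K) && _)) => [/andP[Kx nKy]|_]; last by case: ifP; rewrite ?mulr0.
case: (boolP (_ && _)) => [/andP[Kx' nKy']|_]; last by rewrite mulr0.
rewrite !mulrA -!exprD exchC // 1?eq_sym //; congr (_ * _).
rewrite -signr_odd -[in RHS]signr_odd; congr (_ ^+ nat_of_bool _).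
have h1 := span_exch (ltW x'y') Kx nKy; have h2 := span_exch (ltW xy) Kx' nKy'.
have p1 := span_card_gt0 (ltW xy) Kx; have p2 := span_card_gt0 (ltW x'y') Kx'.
have p3 : (0 < span_card (exch K x' y') x y)%N.
  by apply: span_card_gt0; [exact: ltW | rewrite in_exch Kx xx'].
have p4 : (0 < span_card (exch K x y) x' y')%N.
  by apply: span_card_gt0; [exact: ltW | rewrite in_exch Kx' eq_sym xx'].
move: h1 h2 p1 p2 p3 p4.
move: (span_card K x y) (span_card K x' y') (span_card _ _ _) (span_card _ _ _).
move=> a b c d; case: (ltgtP x x') xx' => // h1 _; case: (ltgtP x y') xy' => // h2 _;
case: (ltgtP x' y) x'y => // h3 _; case: (ltgtP y y') yy' => // h4 _;
move: xy x'y'; lia.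
Qed.
End Hop.

(** * Coefficients of the shifted sums *)

Lemma exchK (K : TT) a b : a \in K -> b \notin K -> exch (exch K a b) b a = K.
Proof.
move=> Ka nKb; have ab : a != b by apply: contraNneq nKb => <-.
apply: TT_ext => z; rewrite !in_exch.
have [->|za] := eqVneq z a; first by rewrite orbT Ka.
by have [->|zb] := eqVneq z b; rewrite ?andbF ?andbT ?orbF ?(negPf nKb).
Qed.

Lemma coef_E' (R : realType) (x y : int) (v : Fock R) K : x < y ->
  coef (E' x y v) K = hop x y (coef v) K.
Proof.
move=> xy.
have hitE (L : TT) : coeff K (E'_basis R x y L) =
    if (x \in K) && (y \notin K) && (L == exch K x y)
    then (-1) ^+ (span_card K x y - 1) else 0.
  rewrite /E'_basis; case: asboolP => [[/inP Ly /inP nLx]|nL]; last first.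
    rewrite raddf0; case: ifP => // /andP[/andP[Kx nKy] /eqP LE].
    case: nL; rewrite LE; split; apply/inP; rewrite in_exch.
      by rewrite eqxx orbT.
    by rewrite Kx eqxx /=; have -> : x == y = false by lia.
  rewrite coeffZ coeffU mul1r -/(span_card L x y).
  have [LE|LK] := eqVneq (exch L y x) K.
    have Lxy : L = exch K x y by rewrite -LE exchK.
    have Kx : x \in K by rewrite -LE in_exch eqxx orbT.
    have nKy : y \notin K.
      by rewrite -LE in_exch eqxx andbF /=; have -> : y == x = false by lia.
    rewrite Lxy eqxx Kx nKy /= mulr1; congr (_ ^+ (_ - 1)).
    by have := span_exch (ltW xy) Kx nKy; rewrite !lexx (ltW xy); lia.
  rewrite mulr0; case: ifP => // /andP[/andP[Kx nKy] /eqP LE].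
  by rewrite LE exchK ?eqxx // in LK.
rewrite /coef {1}/E' -{1}[v]Freeg_dom fglift_Freeg /prelift big_map raddf_sum /=.
under eq_bigr => L _ do rewrite coeffZ hitE.
rewrite /hop; case: ifP => Kxy; last by rewrite big1 // => L _; rewrite mulr0.
have [dv|ndv] := boolP (exch K x y \in dom v).
  rewrite (bigD1_seq _ dv (uniq_dom v)) /= eqxx mulrC big1 ?addr0 // => L.
  by move=> /negPf ->; rewrite mulr0.
rewrite (coeff_outdom ndv) mulr0 big_seq big1 // => L Lv.
by case: eqP => [LE|_]; rewrite ?mulr0 //; rewrite -LE Lv in ndv.
Qed.

(** Summing over one window large enough for several sets makes their
    coefficients comparable term by term. *)
Definition runner_window (n : nat) (p : int) (N : nat) : seq int :=
  [seq x <- zrange (- N%:Z) N | (x == p %[mod n%:Z])%Z].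

Lemma mem_window n p N x :
  (x \in runner_window n p N) = (x == p %[mod n%:Z])%Z && (- N%:Z <= x <= N).
Proof. by rewrite mem_filter mem_zrange //; lia. Qed.

Lemma window_uniq n p N : uniq (runner_window n p N).
Proof. exact/filter_uniq/zrange_uniq. Qed.

Definition bound (K : TT) : nat := projT1 (cid (TT_bounds K)).

Lemma boundP K x : (x <= - (bound K)%:Z -> x \in K) /\ ((bound K)%:Z < x -> x \notin K).
Proof. by rewrite /bound; case: cid => /= N hN; exact: hN. Qed.

(** A hop of [K] leaves a particle and reaches a hole; since [K] has only
    particles far below and only holes far above, it starts in the window. *)
Lemma coef_Ehat (R : realType) n p (d : int) (v : Fock R) K N :
  (0 < n)%N -> 0 < d -> (bound K + `|d| <= N)%N ->
  coef (Ehat n p (p + d) v) K =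
  \sum_(x <- runner_window n p N) hop x (x + d) (coef v) K.
Proof.
move=> n0 d0 hN; pose F k := E' (p + n%:Z * k) (p + d + n%:Z * k) v.
pose pos (k : int) := p + n%:Z * k.
pose ks := [seq ((x - p) %/ n%:Z)%Z | x <- runner_window n p N].
have posK x : x \in runner_window n p N -> pos ((x - p) %/ n%:Z)%Z = x.
  rewrite mem_window eqz_mod_dvd => /andP[/divzK h _].
  by rewrite /pos mulrC h; lia.
have mapK : [seq pos k | k <- ks] = runner_window n p N.
  by rewrite -map_comp -[RHS]map_id; apply/eq_in_map => x /posK.
have uks : uniq ks by apply: (@map_uniq _ _ pos); rewrite mapK window_uniq.
have hopF k : coef (F k) K = hop (pos k) (pos k + d) (coef v) K.
  by rewrite /F coef_E' /pos; [congr hop; lia | lia].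
have out k : k \notin ks -> coef (F k) K = 0.
  move=> nk; rewrite hopF hop0 //; apply: contra nk => /andP[Kk nKk].
  have kw : pos k \in runner_window n p N.
    rewrite mem_window; apply/andP; split; first by apply/congP; exists k.
    have [_ h1] := boundP K (pos k); have [h2 _] := boundP K (pos k + d).
    rewrite Kk in h1; rewrite (negPf nKk) in h2.
    apply/andP; split; rewrite leNgt; apply/negP => h.
      by have := h2 _; lia.
    by have := h1 _; lia.
  apply/mapP; exists (pos k) => //.
  by rewrite /pos addrAC subrr add0r mulrC mulzK //; lia.
rewrite -mapK big_map -(eq_bigr _ (fun k _ => hopF k)).
have finF : finite_set [set k | F k != 0]%classic := Ehat_finite p (p + d) v n0.
pose A := (fset_set [set k | F k != 0]%classic `|` [fset k in ks])%fset.
have -> : Ehat n p (p + d) v = \sum_(k <- A) F k.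
  apply: fsbigTE => k; rewrite !inE in_fset_set // negb_or => /andP[nk _].
  by apply/eqP; apply: contraNT nk => Fk; apply/mem_set.
rewrite /coef raddf_sum /= (bigID (mem ks)) /= [X in _ + X]big1 ?addr0; last first.
  by move=> k /out.
rewrite -big_filter; apply: perm_big; apply: uniq_perm => //.
  exact/filter_uniq/fset_uniq.
by move=> k; rewrite mem_filter !inE; case: (k \in ks); rewrite ?orbT.
Qed.

Lemma Ehat_shift (R : realType) n (p q k : int) (v : Fock R) :
  Ehat n (p + n%:Z * k) (q + n%:Z * k) v = Ehat n p q v.
Proof.
rewrite /Ehat [RHS](reindex_fsbigT (fun l => k + l)) /=; last first.
  by exists (fun l => l - k) => l; lia.
by apply: eq_fsbigr => l _; congr E'; lia.
Qed.

Lemma coef_Ehat_neq0 (R : realType) n (p d : int) (v : Fock R) K :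
  (0 < n)%N -> 0 < d -> coef (Ehat n p (p + d) v) K != 0 ->
  exists k, let x := p + n%:Z * k in
    [/\ x \in K, x + d \notin K & coef v (exch K x (x + d)) != 0].
Proof.
move=> n0 d0; rewrite (@coef_Ehat _ _ _ _ _ _ (bound K + `|d|)) // => nz.
have [x xw hx] : exists2 x, x \in runner_window n p (bound K + `|d|) &
    hop x (x + d) (coef v) K != 0.
  apply: contrapT => nex; case/eqP: nz; rewrite big_seq big1 // => x xw.
  by apply/eqP/contraT => hx; case: nex; exists x.
move: xw; rewrite mem_window => /andP[/congP[k xE] _]; exists k; rewrite -xE.
move: hx; rewrite /hop; case: ifP => [/andP[-> ->]|_]; last by rewrite eqxx.
by move=> hx; split=> //; apply: contraNneq hx => ->; rewrite mulr0.
Qed.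

(** * The support of the vectors *)

(** The value 0 of [ell] also stands for the absence of a stable set, whereas a
    positive value counts the steps to an actual one; this lets an induction on
    [ell] peel off one raising step. *)
Lemma ell_succ n J l : ell n J = l.+1 ->
  [/\ ~ stable n J, ell n (up n J) = l & stable n (iter l.+1 (up n) J)].
Proof.
rewrite /ell; case: xgetP => [m _ [st nst] ml | _ //]; subst m.
split=> //; first exact: (nst 0%N).
have stl : stable n (iter l (up n) (up n J)) by rewrite -iterSr.
apply: xget_unique; first by split=> // i il; rewrite -iterSr; exact: nst.
move=> m [stm nstm]; apply/eqP; rewrite eqn_leq; apply/andP; split; rewrite leqNgt; apply/negP.
  by move=> /nstm.
by move=> ml; apply: (nst m.+1) => //; rewrite iterSr.
Qed.

Lemma ell_iter n J i : (i <= ell n J)%N -> ell n (iter i (up n) J) = (ell n J - i)%N.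
Proof.
elim: i => [|i IH] il; first by rewrite subn0.
have [|_ h _] := @ell_succ n (iter i (up n) J) (ell n J - i.+1); first by rewrite IH; lia.
by rewrite iterS.
Qed.

Lemma ell_unstable n J i : (i < ell n J)%N -> ~ stable n (iter i (up n) J).
Proof.
move=> il; suff /(@ell_succ _ _)[] : ell n (iter i (up n) J) = (ell n J - i.+1).+1 by [].
by rewrite ell_iter; lia.
Qed.

Lemma ell_gt n J i : (0 < ell n J)%N ->
  (forall j, (j < i)%N -> ~ stable n (iter j (up n) J)) -> (i <= ell n J)%N.
Proof.
case lE: (ell n J) => [//|l] _ nst; rewrite leqNgt; apply/negP => li.
by have [_ _] := ell_succ lE; apply: nst.
Qed.

Lemma gap_le_iter n J i : (0 < n)%N -> gap_le n J -> (i <= ell n J)%N ->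
  gap_le n (iter i (up n) J).
Proof.
move=> n0 gJ; elim: i => // i IH il; apply: up_gap_le => //; first by apply: IH; lia.
exact: ell_unstable.
Qed.

Section Vectors.
Variables (R : realType) (n : nat).
Hypothesis n0 : (0 < n)%N.

Lemma vvec_stop J : ell n J = 0%N -> vvec R n J = eps R J.
Proof. by rewrite /vvec /roof => ->. Qed.

Lemma vvec_step J : (0 < ell n J)%N ->
  vvec R n J = Ehat n (upp n J) (upq n J) (vvec R n (up n J)).
Proof.
case lE: (ell n J) => [//|l] _; have [_ lE' _] := ell_succ lE.
rewrite /vvec /roof lE lE' -iterSr.
have i1 : iota 1 l = [seq (1 + i)%N | i <- iota 0 l] := iotaDl 1 0 l.
have i2 : iota 2 l = [seq (2 + i)%N | i <- iota 0 l] := iotaDl 2 0 l.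
rewrite /= i1 i2 !foldr_map.
apply: (congr1 (Ehat n _ _)); elim: (iota 0 l) => //= i s ->.
by rewrite /pstep /qstep /= -?iterSr.
Qed.

(** Compare [K] with [J] through the set [K'] that the last hop comes from and
    that does not exceed [up n J].  Differences at or above [p] are excluded by
    the uniqueness of flush sets. *)
Lemma vvec_support J K : gap_le n J -> coef (vvec R n J) K != 0 ->
  conserved n K J /\ precedes K J.
Proof.
move lE: (ell n J) => l; elim: l J lE K => [|l IH] J lE K gJ.
  rewrite vvec_stop // /coef coeffU mul1r; case: (eqVneq J K) => [<- _ | _]; last by rewrite mulr0n eqxx.
  by split; [exact: conserved_refl | left].
have [nst lE' _] := ell_succ lE; rewrite vvec_step ?lE //.
have [Jp nJp pmax] := uppP nst; have [pq nJq Jq qp _] := upqP n0 gJ nst.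
have gJ' := up_gap_le n0 gJ nst.
have upE x : (x \in up n J) = (x \in J) && (x != upp n J) || (x == upq n J).
  exact: in_up.
move: pq nJq Jq qp upE; set p := upp n J; set q := upq n J => pq nJq Jq qp upE.
have fJ : flush_above n p J by exact: upp_flush.
have fJ' : flush_above n p (up n J) := up_flush n0 gJ nst.
set J' := up n J in upE gJ' fJ' lE' *.
have d0 : 0 < q - p by rewrite subr_gt0.
have nz : 0 < n%:Z by rewrite ltz_nat.
rewrite (_ : q = p + (q - p)); last by lia.
case/coef_Ehat_neq0 => // k; set x := p + n%:Z * k => -[Kx nKy].
set K' := exch K x _ => cK'.
have [cons' prec'] := IH J' lE' K' gJ' cK'.
have xd : x + (q - p) = q + n%:Z * k by rewrite addrAC [p + _]addrC subrK.
have xy : x < q + n%:Z * k by rewrite -xd ltrDl.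
have KE : K = exch K' (q + n%:Z * k) x by rewrite /K' xd exchK // -xd.
have JE : J = exch J' q p by rewrite /J' /up exchK.
have K'E z : (z \in K') = (z \in K) && (z != x) || (z == q + n%:Z * k).
  by rewrite in_exch xd.
have K'x : x \notin K' by rewrite K'E eqxx andbF (lt_eqF xy).
have K'y : q + n%:Z * k \in K' by rewrite K'E eqxx orbT.
have J'p : p \notin J' by rewrite upE eqxx andbF (lt_eqF pq).
have J'q : q \in J' by rewrite upE eqxx orbT.
have consK : conserved n K J by rewrite {1}KE {1}JE; exact: conserved_hop.
split=> //.
have eqK z : z < x -> (z \in K) = (z \in K').
  by move=> zx; rewrite K'E (lt_eqF zx) (lt_eqF (lt_trans zx xy)) andbT orbF.
have eqJ z : z < p -> (z \in J) = (z \in J').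
  by move=> zp; rewrite upE (lt_eqF zp) (lt_eqF (lt_trans zp pq)) andbT orbF.
(* A particle landing below p, on a free position below which K' and the
   raised set agree, already decides the comparison. *)
have low : x < p -> x \notin J' -> (forall z, z < x -> (z \in K') = (z \in J')) ->
    precedes K J.
  move=> xp nJ'x agree; right; exists x; split=> //; first by rewrite eqJ.
  by move=> z zx; rewrite eqK // agree // eqJ // (lt_trans zx).
case: prec' => [K'J'|[u [K'u nJ'u agree]]].
  have [xp|px|xp] := ltgtP x p.
  - by apply: low => //; rewrite -K'J'.
  - have k0 : 0 < k by move: px; rewrite /x ltrDl pmulr_rgt0.
    have yq : q < q + n%:Z * k by rewrite ltrDl pmulr_rgt0.
    have Jy : q + n%:Z * k \in J.
      by move: K'y; rewrite K'J' upE (gt_eqF yq) orbF => /andP[].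
    have := flush_above_sub n0 fJ Jy pq (ltW k0).
    by rewrite (negPf nJq).
  by left; rewrite KE JE K'J' -xd xp addrC subrK.
have xu : x != u by apply: contraNneq K'x => ->.
have [up'|pu|up'] := ltgtP u p.
- have [xu'|ux|xu'] := ltgtP x u; last by rewrite xu' eqxx in xu.
    apply: low; [exact: lt_trans up' | by rewrite -agree |].
    by move=> z zx; apply: agree; exact: lt_trans xu'.
  right; exists u; split; [by rewrite eqK | by rewrite eqJ |].
  by move=> z zu; rewrite eqK ?eqJ ?agree // (lt_trans zu).
- (* Both raised sets agree up to p, so they coincide. *)
  have K'J' : K' = J'.
    by apply: (flush_unique n0 fJ' cons') => z zp; apply: agree; exact: le_lt_trans pu.
  by rewrite -K'J' K'u in nJ'u.
have [xp|px|xp] := ltgtP x p; last by rewrite xp up' eqxx in xu.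
  apply: low => //; last by move=> z zx; apply: agree; rewrite up' (lt_trans zx).
  by rewrite -agree // up'.
left; apply: (flush_unique n0 fJ consK) => z.
rewrite le_eqVlt => /orP[/eqP->|zp].
  by rewrite eqK // -up' K'u up'.
by rewrite eqK ?eqJ ?agree ?up' // (lt_trans zp).
Qed.

End Vectors.

(** * Filling one position *)

Section Fill.
Variables (R : realType) (n : nat) (p : int) (w : Fock R).
Hypothesis n0 : (0 < n)%N.

Definition hops (ds : seq int) : Fock R :=
  foldr (fun d v => Ehat n p (p + d) v) w ds.

Definition delete (ds : seq int) (i : nat) : seq int := take i ds ++ drop i.+1 ds.

(** The vanishing of [w] that forces one of the sums to fill [p]. *)
Fixpoint dead_end (ds : seq int) (K : TT) : Prop :=
  if ds is d :: ds' then
    forall x, (x == p %[mod n%:Z])%Z -> x != p -> x \in K -> x + d \notin K ->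
      dead_end ds' (exch K x (x + d))
  else coef w K = 0.

(** A particle of [K] at [p] has to be put there by exactly one of the sums,
    say the one of length [ds_i]; since the hops commute, that sum can be
    moved to the front. *)
Lemma fill ds K : all (fun d => (0 < d) && ~~ (n%:Z %| d)%Z) ds ->
  p \in K -> dead_end ds K ->
  coef (hops ds) K =
  \sum_(i < size ds) hop p (p + ds`_i) (coef (hops (delete ds i))) K.
Proof.
elim: ds K => [|d ds IH] K; first by rewrite big_ord0.
case/andP=> /andP[d0 nd] dsP Kp dead.
pose N := (bound K + `|p| + \max_(e <- ds) bound (exch K p (p + e)) + `|d|)%N.
rewrite [hops _]/= (@coef_Ehat _ _ _ _ _ _ N) //; last by rewrite /N; lia.
have pW : p \in runner_window n p N by rewrite mem_window eqxx /N; lia.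
rewrite (bigD1_seq _ pW (window_uniq _ _ _)) big_ord_recl /=.
congr (_ + _); first by rewrite /delete /= drop0.
have dsi i : (i < size ds)%N -> (0 < ds`_i) && ~~ (n%:Z %| ds`_i)%Z.
  by move=> ids; apply: (allP dsP); exact: mem_nth.
rewrite big_seq_cond.
transitivity (\sum_(x <- runner_window n p N | (x \in runner_window n p N) && (x != p))
    \sum_(i < size ds) hop p (p + ds`_i) (hop x (x + d) (coef (hops (delete ds i)))) K).
  apply: eq_bigr => x /andP[]; rewrite mem_window => /andP[xp _] xNp.
  rewrite (@eq_hop _ _ _ _ (fun L => \sum_(i < size ds)
     hop p (p + ds`_i) (coef (hops (delete ds i))) L)); last first.
    move=> Kx nKy; apply: IH => //; last exact: dead.
    by rewrite in_exch Kp eq_sym xNp.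
  rewrite hop_sum; apply: eq_bigr => i _.
  have /andP[e0 ne] := dsi i (ltn_ord i).
  move: xp; rewrite eqz_mod_dvd => xp.
  rewrite hopC ?ltrDl //.
    by apply: contraNneq ne => xE; rewrite xE addrC addKr in xp.
  by apply: contraNneq nd => pE; rewrite pE opprD addNKr dvdzE abszN -dvdzE in xp.
rewrite exchange_big; apply: eq_bigr => i _; rewrite -hop_sum; apply: eq_hop => _ _.
have /andP[e0 ne] := dsi i (ltn_ord i).
rewrite [delete _ _]/delete /= (@coef_Ehat _ _ _ _ _ _ N) //; last first.
  have : (bound (exch K p (p + ds`_i)) <= \max_(e <- ds) bound (exch K p (p + e)))%N.
    by apply: leq_bigmax_seq => //; exact: mem_nth.
  by move=> h; rewrite leq_add2r (leq_trans h) // leq_addl.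
rewrite -big_seq_cond [RHS](bigD1_seq _ pW (window_uniq _ _ _)) /= hop0 ?add0r //.
by rewrite in_exch eqxx andbF /= lt_eqF // ltrDl.
Qed.

End Fill.

(** * Raising along one runner *)

Lemma congD (n : nat) (p x k : int) :
  (x + n%:Z * k == p %[mod n%:Z])%Z = (x == p %[mod n%:Z])%Z.
Proof. by rewrite !eqz_mod_dvd addrAC rpredDr // dvdz_mulr. Qed.

Lemma congB (n : nat) (p x : int) :
  (x - n%:Z == p %[mod n%:Z])%Z = (x == p %[mod n%:Z])%Z.
Proof. by rewrite -[RHS](congD n p x (-1)) mulrN1. Qed.

Lemma congDn (n : nat) (p x : int) :
  (x + n%:Z == p %[mod n%:Z])%Z = (x == p %[mod n%:Z])%Z.
Proof. by rewrite -[RHS](congD n p x 1) mulr1. Qed.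

(** Steps are counted from 0, so that [low n J i] is [pstep n J i.+1]. *)
Definition raised n J i : TT := iter i (up n) J.
Definition low n J i : int := upp n (raised n J i).
Definition high n J i : int := upq n (raised n J i).
Definition stride n J i : int := high n J i - low n J i.

Section Phase.
Variables (n : nat) (J : TT) (t : nat).
Hypotheses (n0 : (0 < n)%N) (gJ : gap_le n J) (tell : (t <= ell n J)%N).
Let p := low n J 0.
Hypothesis phase : forall i, (i < t)%N -> (low n J i == p %[mod n%:Z])%Z.

Lemma raised_upqP i : (i < t)%N ->
  [/\ low n J i < high n J i, high n J i \notin raised n J i,
      high n J i - n%:Z \in raised n J i,
      (high n J i != p %[mod n%:Z])%Z &
      forall x, low n J i < x -> x \notin raised n J i ->
        x - n%:Z \in raised n J i -> (x != p %[mod n%:Z])%Z -> high n J i <= x].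
Proof.
move=> it; have il : (i < ell n J)%N by lia.
have gi := gap_le_iter n0 gJ (ltnW il).
have [h1 h2 h3 h4 h5] := upqP n0 gi (ell_unstable il).
by rewrite -/(low n J i) (eqP (phase it)) in h4 h5.
Qed.

Lemma in_raisedS i x : (x \in raised n J i.+1) =
  (x \in raised n J i) && (x != low n J i) || (x == high n J i).
Proof. exact: in_exch. Qed.

(** While the steps stay on the runner of [p], that runner only loses
    particles and the others only gain some. *)
Lemma raised_off i j x : (i <= j <= t)%N -> (x != p %[mod n%:Z])%Z ->
  x \in raised n J i -> x \in raised n J j.
Proof.
move=> /andP[+ jt] xp Ji; elim: j jt => [|j IH] jt; first by rewrite leqn0 => /eqP <-.
rewrite leq_eqVlt => /orP[/eqP <- //|ij]; rewrite in_raisedS IH //; last by lia.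
by rewrite /=; apply/orP; left; apply: contraNneq xp => ->; exact: phase.
Qed.

Lemma raised_on i j x : (i <= j <= t)%N -> (x == p %[mod n%:Z])%Z ->
  x \in raised n J j -> x \in raised n J i.
Proof.
move=> /andP[+ jt] xp; elim: j jt => [|j IH] jt; first by rewrite leqn0 => /eqP <-.
rewrite leq_eqVlt => /orP[/eqP <- //|ij]; rewrite in_raisedS => /orP[/andP[h _]|/eqP xE].
  by apply: IH => //; lia.
by have [_ _ _ ] := raised_upqP jt; rewrite -xE xp.
Qed.

End Phase.

Section Block.
Variables (n : nat) (J : TT) (s : nat).
Hypotheses (n0 : (0 < n)%N) (gJ : gap_le n J) (nst : ~ stable n J).
Let p := low n J 0.
Hypotheses (block_in : forall k, (k < s)%N -> p + n%:Z * k \in J)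
  (block_out : p + n%:Z * s \notin J).

Lemma block_gt0 : (0 < s)%N.
Proof.
have [Jp _ _] := uppP nst; case: s block_out => // ; by rewrite mulr0 addr0 Jp.
Qed.

Lemma block_max (k : int) : 0 <= k -> p + n%:Z * k \in J -> k < s%:Z.
Proof.
move=> k0 Jk; rewrite ltNge; apply/negP => sk.
have fJ : flush_above n p J by exact: upp_flush.
have h : p + n%:Z * s%:Z + n%:Z * (k - s%:Z) \in J.
  by rewrite -addrA -mulrDr addrCA subrr addr0.
suff : false by []; rewrite -(negPf block_out); apply: (flush_above_sub n0 fJ h).
  by rewrite ltrDl pmulr_rgt0 // ltz_nat block_gt0.
by rewrite subr_ge0.
Qed.

(** The block [p], [p + n], [p + 2n], and so on, loses its lowest particle at
    each step.  Nothing changes below [p] and the other runners stay flush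
    above it, so the next particle of the block is the next one to be raised. *)
Lemma blockP i : (i <= s)%N ->
  [/\ gap_le n (raised n J i),
   (forall k : int, (p + n%:Z * k \in raised n J i) =
                    (p + n%:Z * k \in J) && ~~ (0 <= k < i%:Z)),
   (forall x, x < p -> (x \in raised n J i) = (x \in J)),
   (forall x, (x != p %[mod n%:Z])%Z -> p < x -> x \in raised n J i ->
      x - n%:Z \in raised n J i) &
   (i < s)%N -> low n J i = p + n%:Z * i /\ ~ stable n (raised n J i)].
Proof.
have [Jp nJp pmax] := uppP nst; have nz : 0 < n%:Z by rewrite ltz_nat.
have low_next j :
   (forall k : int, (p + n%:Z * k \in raised n J j) =
                    (p + n%:Z * k \in J) && ~~ (0 <= k < j%:Z)) ->
   (forall x, (x != p %[mod n%:Z])%Z -> p < x -> x \in raised n J j ->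
      x - n%:Z \in raised n J j) ->
   (j < s)%N -> low n J j = p + n%:Z * j /\ ~ stable n (raised n J j).
  move=> on off js; apply: upp_eq.
  - by rewrite on block_in //=; lia.
  - have -> : p + n%:Z * j - n%:Z = p + n%:Z * (j%:Z - 1) by lia.
    rewrite on; case: j js {on off} => [|j] js; last by rewrite (_ : (0 <= _ < _) = true) ?andbF //; lia.
    by rewrite sub0r mulrN1 (negPf nJp).
  move=> x Jx pjx; have px : p < x by apply: le_lt_trans pjx; rewrite lerDl; lia.
  have [/congP[k xE]|xp] := boolP (x == p %[mod n%:Z])%Z; last exact: off.
  have kj : j%:Z < k by move: pjx; rewrite xE ltrD2l ltr_pM2l.
  rewrite xE in Jx *; have -> : p + n%:Z * k - n%:Z = p + n%:Z * (k - 1) by lia.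
  move: Jx; rewrite !on => /andP[Jk _].
  have := block_max _ Jk; have := block_in (k := `|k - 1|%N).
  rewrite (_ : `|k - 1|%N%:Z = k - 1); last lia.
  by move=> h h'; rewrite h /=; lia.
elim: i => [|i IH] is_.
  have off0 x : (x != p %[mod n%:Z])%Z -> p < x -> x \in J -> x - n%:Z \in J.
    by move=> _ px Jx; exact: pmax.
  split=> //; first by move=> k; rewrite /= (_ : (0 <= k < 0) = false) ?andbT //; lia.
  by move=> h; split=> //; rewrite mulr0 addr0.
have [gi on below off /(_ is_)[lowE nsti]] := IH (ltnW is_).
have pE k : ((p + n%:Z * k) %% n%:Z = p %% n%:Z)%Z by apply/eqP; rewrite congD.
have [] := upqP n0 gi nsti; rewrite -/(low n J i) -/(high n J i) lowE pE.
move=> pq nJq Jq qp qmin.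
have ppi : p <= p + n%:Z * i by rewrite lerDl mulr_ge0.
have inS x : (x \in raised n J i.+1) =
  (x \in raised n J i) && (x != p + n%:Z * i) || (x == high n J i).
  by rewrite -lowE; exact: in_raisedS.
have onS (k : int) : (p + n%:Z * k \in raised n J i.+1) =
                    (p + n%:Z * k \in J) && ~~ (0 <= k < i.+1%:Z).
  rewrite inS on (inj_eq (addrI p)) (inj_eq (mulfI (lt0r_neq0 nz))).
  rewrite [_ == high n J i](_ : _ = false) ?orbF; last first.
    by apply: contraNF qp => /eqP <-; rewrite congD.
  by rewrite -andbA; congr (_ && _); lia.
have offS x : (x != p %[mod n%:Z])%Z -> p < x -> x \in raised n J i.+1 ->
    x - n%:Z \in raised n J i.+1.
  move=> xp px; rewrite !inS => /orP[/andP[Jx _]|/eqP xE].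
    rewrite off //=; apply/orP; left.
    by apply: contraNneq xp => xE; rewrite -congB xE congD.
  rewrite {1}xE Jq /=; apply/orP; left.
  by apply: contraNneq xp => xE'; rewrite -congB xE' congD.
split=> //; last exact: low_next.
  by apply: up_gap_le.
move=> x xp; rewrite inS below // (lt_eqF (lt_le_trans xp ppi)) andbT.
by rewrite (lt_eqF (lt_trans xp (le_lt_trans ppi pq))) orbF.
Qed.

Lemma block_ell : (0 < ell n J)%N -> (s <= ell n J)%N.
Proof.
move=> l0; apply: ell_gt => // i is_.
by have [_ _ _ _ /(_ is_)[]] := blockP (ltnW is_).
Qed.

Lemma block_phase i : (i < s)%N -> (low n J i == p %[mod n%:Z])%Z.
Proof. by move=> is_; have [_ _ _ _ /(_ is_)[-> _]] := blockP (ltnW is_); rewrite congD. Qed.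

(** The runner that received the previous particle offers its next position
    to the next one. *)
Lemma block_stride_le i j : (0 < ell n J)%N -> (i <= j < s)%N ->
  stride n J j <= stride n J i.
Proof.
move=> l0 /andP[+ js]; elim: j js => [|j IH] js; first by rewrite leqn0 => /eqP->.
rewrite leq_eqVlt => /orP[/eqP-> //|ij]; apply: le_trans (IH (ltnW js) ij).
have sl := block_ell l0.
have [_ _ _ _ /(_ js)[lowE' nst']] := blockP (ltnW js).
have [_ _ _ off' /(_ (ltnW js))[lowE nst0]] := blockP (ltnW (ltnW js)).
have [pq nJq _ qp _] := raised_upqP n0 gJ sl block_phase (ltnW js).
have [_ _ _ _ qmin] := raised_upqP n0 gJ sl block_phase js.
suff : high n J j.+1 <= high n J j + n%:Z by rewrite /stride lowE lowE'; lia.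
apply: qmin.
- by rewrite lowE'; lia.
- rewrite in_raisedS; apply/negP => /orP[/andP[h _]|]; last by lia.
  have := off' _ _ _ h; rewrite addrK (negPf nJq) => h'.
  suff : false by []; apply: h'; first by rewrite congDn.
  by move: pq; rewrite lowE; nia.
- by rewrite addrK in_raisedS eqxx orbT.
- by rewrite congDn.
Qed.

(** Were the position [p + stride n J i] free, so would be the position [n]
    below it, by the minimality of the first target, hence all higher ones on
    that runner; the runner could not have grown up to the target of step [i]
    in only [i] steps. *)
Lemma block_short_stride i : (0 < ell n J)%N -> (i < s)%N ->
  stride n J i < stride n J 0 -> p + stride n J i \in J.
Proof.
move=> l0 is_ short; apply: contraT => nJy.
have sl := block_ell l0; have nz : 0 < n%:Z by rewrite ltz_nat.
have [pq nJq Jq qp qmin] := raised_upqP n0 gJ sl block_phase block_gt0.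
have [pqi nJqi Jqi qpi _] := raised_upqP n0 gJ sl block_phase is_.
have [_ _ _ _ /(_ is_)[lowE _]] := blockP (ltnW is_).
have fJ : flush_above n p J by exact: upp_flush.
have low0 : low n J 0 = p by [].
have grow j : (j < s)%N -> high n J j - n%:Z \in raised n J j.
  by move=> js; have [] := raised_upqP n0 gJ sl block_phase js.
move: short nJy pqi; rewrite /stride lowE low0 => short nJy pqi.
have [y yE] : exists y, y = p + (high n J i - (p + n%:Z * i)) by eexists.
rewrite -yE in nJy; rewrite low0 in pq qmin.
clear lowE l0 nJqi nJq Jq.
have qE : high n J i = y + n%:Z * i by rewrite yE; lia.
have yp : (y != p %[mod n%:Z])%Z by rewrite -(congD _ _ _ i) -qE.
clearbody p.
have py : p < y by rewrite yE ltrDl subr_gt0.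
have yq : y < high n J 0 by rewrite yE addrC -ltrBrDr.
have nJyn : y - n%:Z \notin J.
  by apply: contraL yq => Jyn; rewrite -leNgt; apply: qmin.
suff empty j : (j <= i)%N -> forall k : int, j%:Z <= k ->
    y - n%:Z + n%:Z * k \notin raised n J j.
  have := empty i (leqnn i) i (lexx _).
  by rewrite addrAC -qE Jqi.
elim: j => [|j IH] ji k jk.
  have [->|k0] := eqVneq k 0; first by rewrite mulr0 addr0.
  have kE : y - n%:Z + n%:Z * k = y + n%:Z * (k - 1).
    by rewrite mulrBr mulr1 addrAC addrA.
  rewrite kE; apply: contra nJy => h.
  apply: (flush_above_sub n0 fJ h) => //.
  by rewrite subr_ge0 -gtz0_ge1 lt_neqAle eq_sym k0.
have Jqj := grow j (ltn_trans ji is_).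
have jk1 : j%:Z <= k - 1 by rewrite lerBrDr -PoszD addn1.
rewrite in_raisedS negb_or negb_and IH ?(ltnW ji) //=; last by apply: le_trans jk; rewrite lez_nat.
apply: contraL (IH (ltnW ji) _ jk1) => /eqP zE; rewrite negbK.
by rewrite mulrBr mulr1 addrA zE.
Qed.

End Block.

(** * The diagonal coefficient loses one factor per raising step *)

Lemma delete_const (ds : seq int) i : (i < size ds)%N ->
  (forall j, (j <= i)%N -> ds`_j = ds`_0) -> delete ds i = behead ds.
Proof.
move=> ids dsE; rewrite /delete.
have sz : size (take i ds) = i by rewrite size_takel // ltnW.
apply: (@eq_from_nth _ 0); first by rewrite size_cat sz size_drop size_behead; move: (size ds) ids => m; lia.
move=> k _; rewrite nth_cat sz nth_behead.
case: ltnP => ki; first by rewrite nth_take // dsE ?(ltnW ki) // dsE.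
by rewrite nth_drop; congr (nth _ _ _); lia.
Qed.

Lemma seq_minimum (s : seq int) : s != [::] ->
  exists2 z, z \in s & forall y, y \in s -> z <= y.
Proof.
elim: s => // x [|y s] IH _; first by exists x; rewrite ?inE // => y; rewrite inE => /eqP->.
have [//|z zs zmin] := IH; have [xz|zx] := leP x z.
  exists x; first exact: mem_head.
  by move=> u; rewrite in_cons => /orP[/eqP-> //|/zmin]; exact: le_trans.
exists z; first by rewrite in_cons zs orbT.
by move=> u; rewrite in_cons => /orP[/eqP->|/zmin //]; exact: ltW.
Qed.

Section BlockCoefficient.
Variables (R : realType) (n : nat) (J : TT) (s : nat).
Hypotheses (n0 : (0 < n)%N) (gJ : gap_le n J) (l0 : (0 < ell n J)%N).
Let p := low n J 0.
Hypotheses (block_in : forall k, (k < s)%N -> p + n%:Z * k \in J)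
  (block_out : p + n%:Z * s \notin J).
Let nst : ~ stable n J := @ell_unstable n J 0 l0.
Let w : Fock R := vvec R n (raised n J s).
Let ds : seq int := mkseq (stride n J) s.

Let s0 : (0 < s)%N := block_gt0 nst block_out.
Let sl : (s <= ell n J)%N := block_ell n0 gJ nst block_in block_out l0.

Lemma vvec_hops i : (i <= s)%N -> vvec R n (raised n J i) = hops n p w (drop i ds).
Proof.
move=> is_; rewrite -(subKn is_); elim: (s - i)%N (leq_subr i s) => [|k IH] ks.
  by rewrite subn0 drop_oversize // size_mkseq.
have iS : (s - k)%N = (s - k.+1).+1 by rewrite -subSn.
have is' : (s - k.+1 < s)%N by rewrite ltn_subrL s0.
move: (s - k.+1)%N iS is' => m iS is'; rewrite iS in IH.
have [_ _ _ _ /(_ is')[lowE _]] := blockP n0 gJ nst block_in block_out (ltnW is').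
rewrite (drop_nth 0) ?size_mkseq // nth_mkseq //= -IH; last exact: ltnW.
rewrite vvec_step //; last by rewrite ell_iter ?subn_gt0 ?(leq_trans is') // ltnW // (leq_trans is').
rewrite -/(low n J m) -/(high n J m) -/(raised n J m.+1).
have -> : high n J m = p + stride n J m + n%:Z * m%:Z.
  by rewrite /stride lowE; ring.
by rewrite lowE Ehat_shift.
Qed.

(** Reaching [raised n J s] takes as many hops as the block has particles. If
    none started at [p], one would have started below the block, where it
    leaves a hole that makes the result larger than [raised n J s]. *)
Lemma block_dead_end es rs K :
  all (fun d => (0 < d) && ~~ (n%:Z %| d)%Z) es ->
  uniq rs ->
  (forall z, z \in rs -> [/\ (z == p %[mod n%:Z])%Z, z \in J, z \notin K & z != p]) ->
  (forall y, (y == p %[mod n%:Z])%Z -> y \in K -> y \in J) ->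
  (forall y, (y \in K) != (y \in J) -> exists2 z, z \in rs & z <= y) ->
  (size rs + size es = s)%N -> dead_end n p w es K.
Proof.
elim: es rs K => [|d es IH] rs K /=.
  move=> _ urs rsP onK diff; rewrite addn0 => szrs; apply/eqP/contraT => nz.
  have [g on below _ _] := blockP n0 gJ nst block_in block_out (leqnn s).
  have [_ prec] := vvec_support n0 g nz.
  have [z zrs zmin] : exists2 z, z \in rs & forall y, y \in rs -> z <= y.
    by apply: seq_minimum; rewrite -size_eq0 szrs -lt0n.
  have [zp Jz nKz znp] := rsP z zrs.
  have zp' : z < p.
    rewrite ltNge; apply/negP => pz.
    have : (size rs <= size [seq (p + n%:Z * k%:Z)%R | k <- iota 1 s.-1])%N.
      apply: uniq_leq_size => // y yrs; have [/congP[k yE] Jy _ yp] := rsP y yrs.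
      have k0 : 0 < k.
        have := le_trans pz (zmin y yrs); rewrite yE lerDl pmulr_rge0 ?ltz_nat // le0r.
        by case: eqP => // k0; rewrite yE k0 mulr0 addr0 eqxx in yp.
      rewrite yE in Jy; have ks := block_max n0 nst block_out (ltW k0) Jy.
      apply/mapP; exists `|k|%N; last by rewrite yE gez0_abs // ltW.
      by rewrite mem_iota; lia.
    by rewrite size_map size_iota szrs; lia.
  case: (@precedesN K (raised n J s) z) => //; first by rewrite below.
  move=> y yz; rewrite below ?(lt_trans yz) //; apply/eqP/contraT => /diff[u urs' uy].
  by have := zmin u urs'; rewrite leNgt (le_lt_trans uy yz).
case/andP=> /andP[d0 nd] esP urs rsP onK diff sz x xp xNp Kx nKy.
have xy : x != x + d by rewrite lt_eqF // ltrDl.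
have nxd : (x + d != p %[mod n%:Z])%Z.
  apply: contra nd; move: xp; rewrite !eqz_mod_dvd => xp.
  by rewrite addrAC rpredDl.
have xrs : x \notin rs by apply/negP => /rsP[_ _]; rewrite Kx.
apply: (IH (x :: rs)) => //.
- by rewrite /= xrs.
- move=> z; rewrite in_cons in_exch => /orP[/eqP->|zrs].
    by rewrite eqxx andbF /= xy; split=> //; exact: onK.
  have [zp Jz nKz znp] := rsP z zrs; split=> //; rewrite (negPf nKz) /=.
  by apply: contraNneq nxd => <-.
- move=> y yp; rewrite in_exch => /orP[/andP[Ky _]|/eqP yE]; first exact: onK.
  by rewrite yE (negPf nxd) in yp.
- move=> y; rewrite in_exch.
  have [-> _|yx] := eqVneq y x; first by exists x => //; exact: mem_head.
  have [-> _|yxd] := eqVneq y (x + d).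
    by exists x; [exact: mem_head | rewrite lerDl ltW].
  by rewrite andbT orbF => /diff[z zrs zy]; exists z => //; rewrite in_cons zrs orbT.
- by rewrite /= -sz addSnnS.
Qed.

(** Fill the position [p]: the sums with the first stride, which lead the list
    because the strides decrease, each leave the product that defines the
    vector of [up n J]. *)
Lemma block_coefficient : exists e : nat, acoef R n J J =
  (-1) ^+ e * (count (fun i => stride n J i == stride n J 0) (iota 0 s))%:R *
  acoef R n (up n J) (up n J).
Proof.
have [Jp _ _] := uppP nst.
have [pq nJq _ _ _] := upqP n0 gJ nst.
rewrite -/(low n J 0) -/p in Jp pq; rewrite -/(high n J 0) in pq nJq.
have phase := block_phase n0 gJ nst block_in block_out.
have dsP : all (fun d => (0 < d) && ~~ (n%:Z %| d)%Z) ds.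
  rewrite /ds all_map; apply/allP => i; rewrite mem_iota add0n => /andP[_ is_] /=.
  have [lh _ _ hp _] := raised_upqP n0 gJ sl phase is_.
  rewrite subr_gt0 lh; apply: contra hp; rewrite eqz_mod_dvd => h.
  by rewrite -[high _ _ _](subrK (low n J i)) -addrA rpredDr // -eqz_mod_dvd phase.
have dead : dead_end n p w ds J.
  apply: (@block_dead_end ds [::]) => //; first by move=> y; rewrite eqxx.
  by rewrite size_mkseq.
exists (span_card J p (high n J 0) - 1)%N.
rewrite {1}/acoef -[J in vvec _ _ J]/(raised n J 0) vvec_hops // drop0.
rewrite (fill n0 dsP Jp dead) size_mkseq.
have qE : p + stride n J 0 = high n J 0 by rewrite addrC subrK.
transitivity (\sum_(i < s | stride n J i == stride n J 0)
    ((-1) ^+ (span_card J p (high n J 0) - 1) * acoef R n (up n J) (up n J))).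
  rewrite [RHS]big_mkcond; apply: eq_bigr => i _.
  have is_ := ltn_ord i.
  rewrite nth_mkseq //; case: eqVneq => dE; last first.
    rewrite hop0 // negb_and negbK; apply/orP; right.
    apply: (block_short_stride n0 gJ nst block_in block_out) => //.
    by rewrite lt_neqAle dE (block_stride_le n0 gJ nst block_in block_out).
  rewrite delete_const ?size_mkseq //; last first.
    move=> j ji; have js := leq_ltn_trans ji is_; rewrite !nth_mkseq //.
    apply/eqP; rewrite eq_le (block_stride_le n0 gJ nst block_in block_out) //= -dE.
    by rewrite (block_stride_le n0 gJ nst block_in block_out) // ji.
  rewrite -drop1 -vvec_hops // dE qE /hop Jp nJq /=; congr (_ * _).
rewrite -(big_mkord (fun i => stride n J i == stride n J 0) (fun=> _)).
by rewrite big_const_seq iter_addr_0 /index_iota subn0 mulrAC mulr_natr.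
Qed.

End BlockCoefficient.

(** * Lexicographic comparison of enumerations *)

Lemma elt_lt (J : TT) i j : (i < j)%N -> elt J j < elt J i.
Proof.
elim: j => // j IH; rewrite ltnS leq_eqVlt; have [_ h _] := eltSP J j.
by case/orP=> [/eqP->|/IH] //; exact: lt_trans.
Qed.

Lemma count_above (J : TT) x N (u : seq int) : uniq u ->
  (forall i, (i < N)%N -> elt J i \in u /\ x <= elt J i) -> elt J N < x ->
  count [pred z | (x <= z) && (z \in J)] u = N.
Proof.
move=> uu hi lo; rewrite -size_filter -[RHS](size_iota 0) -[RHS](size_map (elt J)).
apply: perm_size; apply: uniq_perm; first exact: filter_uniq.
  rewrite map_inj_uniq ?iota_uniq // => i j eqij.
  by case: (ltngtP i j) => // /(elt_lt J); rewrite eqij ltxx.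
move=> z; rewrite mem_filter /=; apply/andP/mapP => [[/andP[xz /elt_onto[i zE]] _] | ].
  exists i => //; rewrite mem_iota add0n /= ltnNge; apply/negP.
  rewrite leq_eqVlt => /orP[/eqP iN|/(elt_lt J) Ni].
    by move: lo; rewrite iN zE ltNge xz.
  by move: (lt_trans Ni lo); rewrite zE ltNge xz.
case=> i; rewrite mem_iota add0n /= => /hi[iu xi] ->; by rewrite elt_in xi.
Qed.

Lemma precedes_lexle n (K J : TT) : conserved n K J -> precedes K J -> lexle K J.
Proof.
move=> cKJ [-> | [x [Kx nJx eKJ]]]; [by right | left].
have [N NE] := elt_onto Kx; have [M Mx MJ] := elt_count J x.
have Mx' : elt J M < x.
  by rewrite lt_neqAle Mx andbT; apply: contraNneq nJx => <-; exact: elt_in.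
have one_qp : quasi_periodic n (fun=> 1) by move=> a b k; rewrite !subrr.
have [u uu [us _ sum0]] := conserved_weight
  ([seq elt K i | i <- iota 0 N.+1] ++ [seq elt J i | i <- iota 0 M]) cKJ one_qp.
have cntE (a : pred int) : (count a u)%:Z = \sum_(z <- u) (a z)%:Z.
  by elim: (u) => [|z v IH]; rewrite ?big_nil // big_cons -IH -PoszD.
have countK : count [pred z | (x <= z) && (z \in K)] u = N.+1.
  apply: count_above => // [i iN|]; last by have [_ + _] := eltSP K N; rewrite NE.
  split; first by apply: us; rewrite mem_cat map_f // mem_iota.
  rewrite -NE; move: iN; rewrite ltnS leq_eqVlt => /orP[/eqP->//|/(elt_lt K)].
  exact: ltW.
have countJ : count [pred z | (x <= z) && (z \in J)] u = M.
  apply: count_above => // i iM; split; last exact/ltW/MJ.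
  by apply: us; rewrite mem_cat [X in _ || X]map_f ?orbT // mem_iota.
have {countK countJ} ME : M = N.+1.
  apply/eqP; rewrite -countK -countJ -eqz_nat eq_sym -subr_eq0 !cntE -sumrB.
  rewrite -[X in _ == X]sum0; apply/eqP/eq_bigr => z _ /=; rewrite mulr1.
  by case: leP => // zx; rewrite eKJ // !subrr.
subst M; exists N; split; first by rewrite NE; exact: MJ.
have low z : z < x -> (z \in K) = (z \in J) by exact: eKJ.
move=> i; elim: i => // i IH; rewrite ltnS leq_eqVlt => iN.
have [Ki Ki1 Kmax] := eltSP K i; have [Ji Ji1 Jmax] := eltSP J i.
have [Kx' Jx'] : elt K i.+1 < x /\ elt J i.+1 < x.
  case/orP: iN => [/eqP Ni|Ni]; first by rewrite -{1}NE -{2}Ni {1}Ni.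
  rewrite -(IH Ni) in Ji1; have ix : elt K i < x by rewrite -NE; exact: elt_lt.
  by split; apply: lt_trans ix.
apply/eqP; rewrite eq_le; apply/andP; split.
  apply: Jmax; first by rewrite -low.
  case/orP: iN => [/eqP Ni|/IH <- //].
  by rewrite (lt_trans Kx') // -Ni MJ.
apply: Kmax; first by rewrite low.
case/orP: iN => [/eqP Ni|/IH -> //].
by rewrite -Ni NE Ni.
Qed.

(** * The product of the factors along a run of congruent steps *)

Section LaterStrides.
Variables (n : nat) (J : TT) (s t : nat).
Hypotheses (n0 : (0 < n)%N) (gJ : gap_le n J) (nst : ~ stable n J)
  (tl : (t <= ell n J)%N).
Let p := low n J 0.
Hypotheses (block_in : forall k, (k < s)%N -> p + n%:Z * k \in J)
  (block_out : p + n%:Z * s \notin J)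
  (phase : forall i, (i < t)%N -> (low n J i == p %[mod n%:Z])%Z).

(** Once the block has gone, a later step starts below [p]; had it the first
    stride, it would end below the first target, on the same runner, hence at
    an occupied position. *)
Lemma later_stride_neq i : (s <= i < t)%N -> stride n J i != stride n J 0.
Proof.
move=> /andP[si it]; have s0 := block_gt0 nst block_out.
have nz : 0 < n%:Z by rewrite ltz_nat.
have t0 : (0 < t)%N by apply: leq_ltn_trans it.
have [pq nJq _ qp _] := raised_upqP n0 gJ tl phase t0.
have [pqi nJqi Jqi qpi _] := raised_upqP n0 gJ tl phase it.
have [_ on _ _ _] := blockP n0 gJ nst block_in block_out (leqnn s).
have il : (i < ell n J)%N := leq_trans it tl.
have nsti := ell_unstable il.
have [Jpi _ _] := uppP nsti; rewrite -/(low n J i) -/(raised n J i) in Jpi.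
have fi : flush_above n (low n J i) (raised n J i) by exact: upp_flush.
have lp : low n J i < p.
  have : low n J i \in raised n J s.
    by apply: (raised_on n0 gJ tl phase _ _ Jpi); [rewrite si ltnW | exact: phase].
  have /congP[k ->] := phase it; rewrite on gtrDl pmulr_rlt0 //.
  case: (ltP k 0) => //= k0 /andP[Jk /negP[]].
  by rewrite (block_max n0 nst block_out).
apply/negP => /eqP dE.
have [k qE] : exists k, high n J 0 = high n J i + n%:Z * k.
  have /congP[k lE] := phase it; exists (- k).
  move: dE; rewrite /stride -/p lE; move: (n%:Z * k) (n%:Z * - k) (mulrN n%:Z k) => a b ->; lia.
have k0 : 0 <= k.
  rewrite leNgt; apply/negP => k0.
  have : high n J i < high n J 0 by move: dE lp; rewrite /stride -/p; lia.
  by rewrite qE ltrDl pmulr_rgt0 // ltNge (ltW k0).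
have Jq0 : high n J 0 \in raised n J i.
  apply: (raised_off n0 tl phase (i := 1)) => //; last by rewrite in_raisedS eqxx orbT.
  by rewrite (leq_trans s0 si) ltnW.
rewrite qE in Jq0; have := flush_above_sub n0 fi Jq0 pqi k0.
by rewrite (negPf nJqi).
Qed.

End LaterStrides.

(** The factors lost at the successive steps of a run of strides [ds]. *)
Fixpoint suffix_mult (ds : seq int) : nat :=
  if ds is d :: ds' then (count_mem d ds * suffix_mult ds')%N else 1%N.

(** From the right, the occurrences of one value contribute 1, 2, 3, and so
    on. *)
Lemma suffix_multE (ds : seq int) N : all (fun d => 0 < d < N%:Z) ds ->
  suffix_mult ds = (\prod_(d <- iota 1 N) (count_mem d%:Z ds)`!)%N.
Proof.
elim: ds => [|d ds IH] /=; first by rewrite big1.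
case/andP=> /andP[d0 dN] dsP; rewrite IH // eqxx add1n.
have dE : d = `|d|%N%:Z by rewrite gtz0_abs.
have dI : `|d|%N \in iota 1 N by rewrite mem_iota; lia.
rewrite (bigD1_seq `|d|%N) ?iota_uniq //= [in RHS](bigD1_seq `|d|%N) ?iota_uniq //=.
rewrite -dE eqxx add1n factS mulnA; congr (_ * _)%N.
apply: eq_bigr => e ed; rewrite [d == _](_ : _ = false) //.
by apply: contraNF ed => /eqP ->.
Qed.

Section Diagonal.
Variables (R : realType) (n : nat).
Hypothesis n0 : (0 < n)%N.

(** The hypothesis on step [t] makes the run end with a complete block, so that
    the factor of a step, a count within its block, is also a count within the
    run. *)
Lemma diagonal_run t J (c : int) : gap_le n J -> (t <= ell n J)%N ->
  (forall i, (i < t)%N -> (low n J i == c %[mod n%:Z])%Z) ->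
  (t < ell n J)%N ==> (low n J t != c %[mod n%:Z])%Z ->
  exists e : nat, acoef R n J J =
    (-1) ^+ e * (suffix_mult (mkseq (stride n J) t))%:R *
    acoef R n (raised n J t) (raised n J t).
Proof.
elim: t J => [|t IH] J gJ tl phase end_t.
  by exists 0%N; rewrite expr0 !mul1r.
have l0 : (0 < ell n J)%N by apply: leq_trans tl.
have nst : ~ stable n J := @ell_unstable n J 0 l0.
have raisedS i : raised n (up n J) i = raised n J i.+1 by rewrite /raised -iterSr.
have lowS i : low n (up n J) i = low n J i.+1 by rewrite /low raisedS.
have strideS i : stride n (up n J) i = stride n J i.+1.
  by rewrite /stride /high lowS raisedS.
have ellS : ell n (up n J) = (ell n J).-1 by rewrite -subn1 -(@ell_iter n J 1).
have [||||e' IHe] := IH (up n J).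
- exact: up_gap_le.
- by rewrite ellS; lia.
- by move=> i it; rewrite lowS; exact: phase.
- by rewrite ellS lowS; move: end_t; rewrite (_ : (t < _)%N = (t.+1 < ell n J)%N) //; lia.
set p := low n J 0.
have phase0 i : (i < t.+1)%N -> (low n J i == p %[mod n%:Z])%Z.
  by move=> it; rewrite (eqP (phase i it)) eq_sym; exact: phase.
have exs : exists s : nat, p + n%:Z * s \notin J.
  by exists (`|p| + bound J).+1; apply: (boundP J _).2; nia.
have [s block_out smin] := ex_minnP exs.
have block_in k : (k < s)%N -> p + n%:Z * k \in J.
  by move=> ks; apply: contraT => /smin; rewrite leqNgt ks.
have s0 := block_gt0 nst block_out.
have st : (s <= t.+1)%N.
  rewrite leqNgt; apply/negP => ts.
  have sl := block_ell n0 gJ nst block_in block_out l0.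
  have [_ _ _ _ /(_ ts)[lowE _]] := blockP n0 gJ nst block_in block_out (ltnW ts).
  move: end_t; rewrite (leq_trans ts sl) lowE congD /= => /negP[].
  exact: phase.
have [e ->] := block_coefficient R n0 gJ l0 block_in block_out.
exists (e + e')%N; rewrite IHe raisedS.
have -> : suffix_mult (mkseq (stride n J) t.+1) =
   (count (fun i => stride n J i == stride n J 0) (iota 0 s) *
    suffix_mult (mkseq (stride n (up n J)) t))%N.
  have -> : mkseq (stride n J) t.+1 = stride n J 0 :: mkseq (stride n (up n J)) t.
    rewrite /mkseq /= (iotaDl 1 0 t) -map_comp; congr cons.
    by apply: eq_map => i; rewrite /= strideS.
  rewrite [LHS]/=; congr (_ * _)%N.
  transitivity (count (fun i => stride n J i == stride n J 0) (iota 0 t.+1)).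
    rewrite /= (iotaDl 1 0 t) /mkseq !count_map; congr (_ + _)%N.
    by apply: eq_count => i; rewrite /= strideS.
  rewrite -(subnKC st) iotaD count_cat [X in (_ + X)%N](_ : _ = 0%N) ?addn0 //.
  apply/eqP; rewrite -leqn0 leqNgt -has_count; apply/hasPn => i.
  rewrite mem_iota add0n subnKC // => ist.
  exact: (later_stride_neq n0 gJ nst tl block_in block_out phase0).
rewrite natrM exprD; move: (acoef _ _ _ _) (_%:R) (_%:R) => a b c'; ring.
Qed.

Lemma acoef_eps J : ell n J = 0%N -> acoef R n J J = 1.
Proof. by move=> lE; rewrite /acoef vvec_stop // /coef coeffU eqxx mulr1. Qed.

Lemma tmaxP J : (0 < ell n J)%N ->
  [/\ (0 < tmax n J <= ell n J)%N,
      forall i, (i < tmax n J)%N -> (low n J i == low n J 0 %[mod n%:Z])%Z &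
      (tmax n J < ell n J)%N -> (low n J (tmax n J) != low n J 0 %[mod n%:Z])%Z].
Proof.
move=> l0; pose P t := all (fun i => (pstep n J i == pstep n J 1 %[mod n%:Z])%Z) (iota 1 t).
have PE t : P t = [forall i : 'I_t, (low n J i == low n J 0 %[mod n%:Z])%Z].
  rewrite /P (iotaDl 1 0 t) all_map; apply/allP/forallP => h i.
    by have := h i; rewrite mem_iota /= => /(_ (ltn_ord i)).
  by rewrite mem_iota => it; exact: (h (Ordinal it)).
have Ptmax : P (tmax n J) && (tmax n J <= ell n J)%N.
  have [|t Pt tE] := @eq_bigmax_cond _ (fun t : 'I_(ell n J).+1 => P t) (fun t => t : nat).
    by apply/card_gt0P; exists ord0.
  by rewrite /tmax tE; apply/andP; split; [exact: Pt | rewrite -ltnS ltn_ord].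
have tmax_ge t : (t <= ell n J)%N -> P t -> (t <= tmax n J)%N.
  by move=> tl Pt; apply: (leq_bigmax_cond (Ordinal (tl : (t < (ell n J).+1)%N))).
have /andP[] := Ptmax; rewrite PE => /forallP Pt tl; split.
- by rewrite tl andbT; apply: tmax_ge => //; rewrite /P /= eqxx.
- by move=> i it; exact: (Pt (Ordinal it)).
move=> tl'; apply/negP => h; have := tmax_ge _ tl'; rewrite ltnn => H.
suff : false by []; apply: H; rewrite PE; apply/forallP => i.
by have := ltn_ord i; rewrite ltnS leq_eqVlt => /orP[/eqP-> //|it]; exact: (Pt (Ordinal it)).
Qed.

Lemma prod_muE J : gap_le n J -> (0 < ell n J)%N ->
  prod_mu n J = suffix_mult (mkseq (stride n J) (tmax n J)).
Proof.
move=> gJ l0; have [/andP[_ tl] phase _] := tmaxP l0.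
have muE d : mu n J d = count_mem d%:Z (mkseq (stride n J) (tmax n J)).
  rewrite /mu (iotaDl 1 0) /mkseq !count_map; exact: eq_count.
pose N := (\max_(i < tmax n J) `|stride n J i|).+1.
have sN : all (fun d => 0 < d < N%:Z) (mkseq (stride n J) (tmax n J)).
  rewrite all_map; apply/allP => i; rewrite mem_iota add0n /= => it.
  have [lh _ _ _ _] := raised_upqP n0 gJ tl phase it.
  have s0 : 0 < stride n J i by rewrite subr_gt0.
  rewrite s0 /=; have := @leq_bigmax 'I_(tmax n J) (fun i => `|stride n J i|%N) (Ordinal it).
  by rewrite -{2}(gtz0_abs s0) ltz_nat ltnS.
have iota_gt0 d : d \in iota 1 N -> (0 < d)%N by rewrite mem_iota => /andP[].
have iota_out d : (0 < d)%N -> d \notin iota 1 N -> mu n J d = 0%N.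
  move=> d0; rewrite mem_iota d0 /= add1n ltnS -ltnNge => Nd; rewrite muE.
  by apply/count_memPn/negP => /(allP sN) /andP[_]; rewrite ltz_nat ltnNge ltnW.
rewrite (suffix_multE sN) /prod_mu (@fsbigE _ _ _ _ _ (iota 1 N)) ?iota_uniq //.
- rewrite big_seq_cond [RHS]big_seq; apply: eq_big => [d|d _]; last by rewrite muE.
  by apply: andb_idr => /iota_gt0 d0; exact/mem_set.
- by move=> d /= d0 /(iota_out d d0) ->.
Qed.

End Diagonal.

(** * Diagonal coefficients up to the end of the first run *)

Lemma suffix_mult_gt0 (ds : seq int) : (0 < suffix_mult ds)%N.
Proof. by elim: ds => //= d ds IH; rewrite eqxx muln_gt0 add1n. Qed.

Section Consequences.
Variables (R : realType) (n : nat).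
Hypothesis n0 : (0 < n)%N.

Lemma diagonal_tmax J : gap_le n J -> (0 < ell n J)%N ->
  exists e : nat, acoef R n J J =
    (-1) ^+ e * (prod_mu n J)%:R * acoef R n (Jtilde n J) (Jtilde n J).
Proof.
move=> gJ l0; have [/andP[t0 tl] phase end_t] := tmaxP l0.
rewrite (prod_muE n0 gJ l0).
exact: (diagonal_run R n0 gJ tl phase (introT implyP end_t)).
Qed.

Lemma acoef_diag_neq0 J : gap_le n J -> acoef R n J J != 0.
Proof.
move: {2}(ell n J).+1 (ltnSn (ell n J)) => l; elim: l J => // l IH J lE gJ.
have [l0|] := posnP (ell n J); first by rewrite acoef_eps // oner_neq0.
move=> l0; have [/andP[t0 tl] _ _] := tmaxP l0.
have [e ->] := diagonal_tmax gJ l0.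
rewrite !mulf_neq0 ?signr_eq0 //.
  by rewrite pnatr_eq0 (prod_muE n0 gJ l0) -lt0n suffix_mult_gt0.
apply: IH; last exact: gap_le_iter.
by rewrite ell_iter //; lia.
Qed.

End Consequences.

Theorem proposition3 (R : realType) (n : nat) (hn : (2 <= n)%N) (m : int) :
  (forall J K : TT, CL n m J -> acoef R n J K != 0 -> lexle K J) /\
  (forall J : TT, CL n m J ->
     [/\ acoef R n J J != 0,
         stable n J -> acoef R n J J = 1
       & ~ stable n J ->
         let a := (prod_mu n J)%:R * acoef R n (Jtilde n J) (Jtilde n J) in
         acoef R n J J = a \/ acoef R n J J = - a ]).
Proof.
have n0 : (0 < n)%N by apply: ltnW.
split=> [J K [_ /gap_le_bounded gJ] nz | J [_ /gap_le_bounded gJ]].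
  by have [cons prec] := vvec_support n0 gJ nz; exact: precedes_lexle cons prec.
split; first exact: acoef_diag_neq0.
  move=> st; apply: acoef_eps; case lE: (ell n J) => [//|l].
  by have [] := ell_succ lE.
move=> _ a; rewrite /a.
(* When [ell] is 0 the vector is [eps J], and the run is empty. *)
have [l0|] := posnP (ell n J).
  have t0 : tmax n J = 0%N.
    by rewrite /tmax; apply: big1 => t _; have := ltn_ord t; lia.
  have -> : prod_mu n J = 1%N.
    by apply: fsbig1 => d _; rewrite /mu t0.
  by left; rewrite /Jtilde t0 mul1r.
move=> l0; have [e ->] := diagonal_tmax R n0 gJ l0.
rewrite -signr_odd; case: (odd e); [right | left].
  by rewrite expr1 mulN1r mulNr.
by rewrite expr0 mul1r.
Qed.
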